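(* Let $n\geq 2$ be an integer and let $0<\alpha<2$. Let $u:\mathbf{R}^n\to\mathbf{R}$ be a strong solution of $$\begin{cases}(-\Delta)^{\alpha/2}u(x)=0, & x\in\mathbf{R}^n,\\ u(x)\geq 0, & x\in\mathbf{R}^n.\end{cases}$$ Then $u\equiv C$ for some constant $C$.
   Context: Let $L_\alpha=\left\{u:\mathbf{R}^n\to\mathbf{R} \;\middle|\; \int_{\mathbf{R}^n}\frac{|u(x)|}{1+|x|^{n+\alpha}}\,dx<\infty\right\}$ (measurable real-valued functions). For $0<\alpha<2$ the fractional Laplacian is given pointwise by $$(-\Delta)^{\alpha/2}u(x)=C_{n,\alpha}\,\mathrm{PV}\int_{\mathbf{R}^n}\frac{u(x)-u(z)}{|x-z|^{n+\alpha}}\,dz,$$ where $\mathrm{PV}$ is the Cauchy principal value, i.e. the limit as $\varepsilon\to0^+$ of the integral over $\{z:|x-z|>\varepsilon\}$, and $C_{n,\alpha}>0$ is the normalization constant for which $\widehat{(-\Delta)^{\alpha/2}u}(\xi)=|\xi|^\alpha\hat u(\xi)$ for all Schwartz functions $u$. A function $u\geq 0$ is a strong solution of the problem $$\begin{cases}(-\Delta)^{\alpha/2}u(x)=0, & x\in\mathbf{R}^n,\\ u(x)\geq 0, & x\in\mathbf{R}^n,\end{cases}$$ if $u\in L_\alpha$ and, for every $x\in\mathbf{R}^n$, the expression $C_{n,\alpha}\,\mathrm{PV}\int_{\mathbf{R}^n}\frac{u(x)-u(z)}{|x-z|^{n+\alpha}}\,dz$ is well defined and equals zero. *)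

(* Defs.v *)
From HB Require Import structures.
From mathcomp Require Import all_boot all_order all_algebra.
From mathcomp Require Import all_classical all_reals all_analysis.
From mathcomp.real_closed Require Import complex.

Set Implicit Arguments.
Unset Strict Implicit.
Unset Printing Implicit Defensive.
Import Order.TTheory GRing.Theory Num.Theory.
Import numFieldNormedType.Exports.
Local Open Scope classical_set_scope.
Local Open Scope ring_scope.

(** Points of R^n are row vectors.  The norm [`|x|] that the library puts on
    ['rV[R]_n] is the max norm; it defines the usual topology and notion of
    differentiability, but lengths have to be measured with [enorm]. *)

Section Euclidean.
Context {R : realType} {n : nat}.
Implicit Types x y : 'rV[R]_n.

Definition dotv x y : R := \sum_(i < n) x ord0 i * y ord0 i.

Definition enorm x : R := Num.sqrt (dotv x x).

End Euclidean.

(** The Borel (product) sigma-algebra of R^n, generated by the coordinates. *)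

Definition rV_display : measure_display -> measure_display.
Proof. exact. Qed.

Section rV_measurable.
Context {R : realType} (n : nat).

Let coors : 'I_n -> 'rV[R]_n -> R := fun i x => x ord0 i.

Let rV_set0 : g_sigma_preimage coors set0.
Proof. exact: sigma_algebra0. Qed.

Let rV_setC A : g_sigma_preimage coors A -> g_sigma_preimage coors (~` A).
Proof. exact: sigma_algebraC. Qed.

Let rV_bigcup (F : _^nat) : (forall i, g_sigma_preimage coors (F i)) ->
  g_sigma_preimage coors (\bigcup_i (F i)).
Proof. exact: sigma_algebra_bigcup. Qed.

HB.instance Definition _ := @isMeasurable.Build
  (rV_display default_measure_display) 'rV[R]_n (g_sigma_preimage coors) rV_set0 rV_setC rV_bigcup.

End rV_measurable.

Lemma measurable_coord (R : realType) n (i : 'I_n) :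
  measurable_fun [set: 'rV[R]_n] (fun x : 'rV[R]_n => x ord0 i).
Proof.
move=> _ Y mY; rewrite setTI; apply: sub_sigma_algebra => /=.
rewrite -bigcup_seq/=; exists i => /=; first by rewrite mem_index_enum.
by exists Y => //; rewrite setTI.
Qed.

Lemma measurable_fun_coordP d (T : measurableType d) (R : realType) n
    (f : T -> 'rV[R]_n) :
  (forall i, measurable_fun [set: T] (fun t => f t ord0 i)) ->
  measurable_fun [set: T] f.
Proof.
move=> mf.
suff H : g_sigma_preimage (fun (i : 'I_n) t => f t ord0 i) `<=` measurable.
  move=> _ A mA; apply: H.
  have := g_sigma_preimage_comp (fun (i : 'I_n) (x : 'rV[R]_n) => x ord0 i) f.
  by rewrite /comp => ->; exists A.
apply: smallest_sub; first exact: sigma_algebra_measurable.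
case: n => [|n] in f mf *; first by rewrite big_ord0.
rewrite -bigcup_mkord_ord; apply: bigcup_sub => i Ii.
by move=> A [B mB <-]; exact: mf.
Qed.

Section consv.
Context {R : realType} (n : nat).

Definition consv (p : R * 'rV[R]_n) : 'rV[R]_n.+1 :=
  \row_i (if unlift ord0 i is Some j then p.2 ord0 j else p.1).

Definition unconsv (x : 'rV[R]_n.+1) : R * 'rV[R]_n :=
  (x ord0 ord0, \row_i x ord0 (lift ord0 i)).

Lemma consvK : cancel consv unconsv.
Proof.
move=> [a v]; rewrite /unconsv /consv /=; congr pair.
  by rewrite mxE unlift_none.
by apply/rowP => i; rewrite !mxE liftK.
Qed.

Lemma measurable_consv : measurable_fun [set: R * 'rV[R]_n] consv.
Proof.
apply: measurable_fun_coordP => i; under eq_fun do rewrite mxE.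
case: unliftP => [j _|_]; last exact: measurable_fst.
exact: (measurableT_comp (measurable_coord j) measurable_snd).
Qed.

Lemma measurable_unconsv : measurable_fun [set: 'rV[R]_n.+1] unconsv.
Proof.
apply/measurable_fun_pairP; split; first exact: measurable_coord.
apply: measurable_fun_coordP => i /=.
under eq_fun do rewrite mxE; exact: measurable_coord.
Qed.

End consv.

Section lebesgue_step.
Local Open Scope ereal_scope.
Context {R : realType} (n : nat).
Variable m : {sigma_finite_measure set 'rV[R]_n -> \bar R}.

Definition lebesgue_step : set 'rV[R]_n.+1 -> \bar R :=
  pushforward (@lebesgue_measure R \x m) (@consv R n).

Let step0 : lebesgue_step set0 = 0.
Proof. by rewrite /lebesgue_step /pushforward preimage_set0 measure0. Qed.

Let step_ge0 A : 0 <= lebesgue_step A.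
Proof. by rewrite /lebesgue_step /pushforward measure_ge0. Qed.

Let step_sigma_additive : semi_sigma_additive lebesgue_step.
Proof.
move=> F mF tF mUF; rewrite /lebesgue_step /pushforward preimage_bigcup.
apply: measure_semi_sigma_additive.
- by move=> k; rewrite -[X in measurable X]setTI; exact: measurable_consv.
- apply/trivIsetP => /= i j _ _ ij; rewrite -preimage_setI.
  by move/trivIsetP : tF => /(_ _ _ _ _ ij) ->//; rewrite preimage_set0.
- rewrite -preimage_bigcup -[X in measurable X]setTI.
  exact: measurable_consv.
Qed.

HB.instance Definition _ := isMeasure.Build _ _ _ lebesgue_step
  step0 step_ge0 step_sigma_additive.

Let step_sigma_finite : sigma_finite setT lebesgue_step.
Proof.
have /sigma_finiteP[F [FT ndF Foo]] := sigma_finiteT (@lebesgue_measure R).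
have /sigma_finiteP[G [GT ndG Goo]] := sigma_finiteT m.
exists (fun k => @unconsv R n @^-1` (F k `*` G k)) => [|k].
  apply/esym; rewrite -subTset => x _.
  have [i _ Fi] : (\bigcup_k F k) (unconsv x).1 by rewrite -FT.
  have [j _ Gj] : (\bigcup_k G k) (unconsv x).2 by rewrite -GT.
  exists (maxn i j) => //; split.
  - by move: Fi; exact/subsetPset/ndF/leq_maxl.
  - by move: Gj; exact/subsetPset/ndG/leq_maxr.
have [mF Fk] := Foo k; have [mG Gk] := Goo k; split.
  rewrite -[X in measurable X]setTI; apply: measurable_unconsv => //.
  exact: measurableX.
rewrite /lebesgue_step /pushforward -comp_preimage.
rewrite (_ : _ \o _ = id) ?preimage_id; last exact/funext/consvK.
by rewrite product_measure1E// lte_mul_pinfty// ge0_fin_numE.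
Qed.

HB.instance Definition _ := Measure_isSigmaFinite.Build _ _ _ lebesgue_step
  step_sigma_finite.

End lebesgue_step.

(** Lebesgue measure on the Borel sets of R^n: R^0 is a point of mass 1, and
    R^(n+1) = R * R^n carries the product measure. *)
Fixpoint borel_lebesgue (R : realType) (n : nat) :
    {sigma_finite_measure set 'rV[R]_n -> \bar R} :=
  match n with
  | 0 => \d_(0 : 'rV[R]_0)
  | k.+1 => lebesgue_step (borel_lebesgue R k)
  end.

(** [Rn R n] is ['rV[R]_n] with the sigma-algebra of Lebesgue measurable sets,
    and [lebesgue_rV] is the (complete) Lebesgue measure on it. *)
Definition Rn (R : realType) (n : nat) : measurableType _ :=
  caratheodory_type ((borel_lebesgue R n)^*)%mu.

Definition lebesgue_rV (R : realType) (n : nat) :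
    {measure set (Rn R n) -> \bar R} :=
  @completed_measure_extension _ _ _ (borel_lebesgue R n).

Section FractionalLaplacian.
Context {R : realType} {n : nat}.
Variables (C alpha : R).
Implicit Types (u : 'rV[R]_n -> R) (x z : 'rV[R]_n) (eps : R).

Local Notation mu := (lebesgue_rV R n).

Definition L_alpha u :=
  measurable_fun [set: Rn R n] (u : Rn R n -> R) /\
  (\int[mu]_x (`|u x| / (1 + enorm x `^ (n%:R + alpha)))%:E < +oo)%E.

(** The principal value at [x] is the limit of [truncated_integral u x eps] as
    eps -> 0+.  Integrals and limits being total functions, [pv_defined] states
    that it is well defined: every truncated integral converges absolutely, and
    their limit exists in R. *)
Definition pv_integrand u x z : R :=
  (u x - u z) / enorm (x - z) `^ (n%:R + alpha).

Definition far x eps : set (Rn R n) := [set z : 'rV[R]_n | enorm (x - z) > eps].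

Definition truncated_integral u x eps : R :=
  \int[mu]_(z in far x eps) pv_integrand u x z.

Definition pv_defined u x :=
  (forall eps, 0 < eps ->
     mu.-integrable (far x eps) (EFin \o pv_integrand u x)) /\
  cvg (truncated_integral u x @ 0^'+).

Definition frac_laplacian u x : R := C * lim (truncated_integral u x @ 0^'+).

Definition strong_solution u :=
  [/\ forall x, 0 <= u x,
      L_alpha u &
      forall x, pv_defined u x /\ frac_laplacian u x = 0].

End FractionalLaplacian.

Section Normalization.
Context {R : realType} (n : nat).
Implicit Types (u : 'rV[R]_n -> R) (x xi : 'rV[R]_n) (s : seq 'I_n).

Local Notation mu := (lebesgue_rV R n).

(** The iterated partial derivative of [u] in the directions listed in [s]. *)
Definition partials s u : 'rV[R]_n -> R :=
  foldr (fun i f => fun x => 'D_(delta_mx ord0 i) f x) u s.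

Definition schwartz u :=
  (forall s x, differentiable (partials s u) x) /\
  (forall s (k : nat), exists M : R, forall x,
     enorm x ^+ k * `|partials s u x| <= M).

(** hat u (xi) = int u(x) exp(- i x.xi) dx.  The symbol of the Laplacian is
    |xi|^2 for this choice of frequency; a constant factor in front of the
    integral would be immaterial below. *)
Definition fourier u xi : R[i] :=
  Complex (\int[mu]_x (u x * cos (dotv x xi)))
          (- \int[mu]_x (u x * sin (dotv x xi))).

(** [u] real-valued is enough: both sides are linear in [u]. *)
Definition normalization_constant (alpha C : R) :=
  0 < C /\
  forall u, schwartz u -> forall xi,
    fourier (frac_laplacian C alpha u) xi =
    (enorm xi `^ alpha)%:C%C * fourier u xi.

End Normalization.

(* Main.v *)
(** Let I(x, e) = u(x) k(x, e) - m(x, e) be the integral truncated at e (below,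
    [resid]), with k(x, e) the integral of |x - z|^-(n + alpha) over |x - z| > e.

    If u - u(x) lies below a linear function plus K |z - x|^2 on a ball of radius
    rho around x, then I(x, rho) <= c K rho^(2 - alpha), because the linear part
    integrates to 0 over annuli and I(x, e) -> 0.  Touching u by paraboloids thus
    gives, where u is continuous, a lower and an upper Harnack bound, hence
    u x <= C u y when u is continuous everywhere; applied to u - inf u this shows
    that u is constant.

    Only measurability of u is assumed, so continuity has to be proved.  Let E be
    the closed set of points having no neighbourhood on which u is continuous.
    By Baire's theorem in E, if E is nonempty there is a ball B meeting E such
    that I(x, e) is bounded uniformly for x in E and B and small e; so u restricted
    to E is continuous in B.  Off E, the Harnack bound on a ball avoiding E
    compares u at its centre with the tail of u at the nearest point of E, so u is
    bounded near each point of E in B; this is where u >= 0 is essential.  Finally,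
    if the limsup om of u at a point y of E in B exceeded u(y), a paraboloid
    touching u from above on a ball avoiding E, of radius d comparable to its
    distance to E, would force u to be close to om on most of
    the space at scale d, while the bound on I at the nearest point of E forces
    its average at that scale to be close to u(y).  The same applies to -u, so
    u is continuous in B, a contradiction. *)

Require Import Defs.
From mathcomp Require Import all_boot all_order all_algebra.
From mathcomp Require Import all_classical all_reals all_analysis.
From mathcomp Require Import measurable_realfun ring lra.
Import Order.TTheory GRing.Theory Num.Theory.
Import numFieldNormedType.Exports.
Local Open Scope classical_set_scope.
Local Open Scope ring_scope.
Set Implicit Arguments.
Unset Strict Implicit.
Unset Printing Implicit Defensive.

(** * Euclidean norm *)

Section Enorm.
Context {R : realType} {n : nat}.
Implicit Types x y z : 'rV[R]_n.

Lemma dotvv_ge0 x : 0 <= dotv x x.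
Proof. by apply: sumr_ge0 => i _; rewrite -expr2 sqr_ge0. Qed.

Lemma enorm_ge0 x : 0 <= enorm x.
Proof. exact: sqrtr_ge0. Qed.

Lemma sqr_enorm x : enorm x ^+ 2 = dotv x x.
Proof. by rewrite sqr_sqrtr// dotvv_ge0. Qed.

Lemma dotvC x y : dotv x y = dotv y x.
Proof. by apply: eq_bigr => i _; rewrite mulrC. Qed.

Lemma dotvDl x y z : dotv (x + y) z = dotv x z + dotv y z.
Proof. by rewrite /dotv -big_split; apply: eq_bigr => i _; rewrite mxE mulrDl. Qed.

Lemma dotvNl x z : dotv (- x) z = - dotv x z.
Proof. by rewrite /dotv -sumrN; apply: eq_bigr => i _; rewrite mxE mulNr. Qed.

Lemma dotvZl a x z : dotv (a *: x) z = a * dotv x z.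
Proof. by rewrite /dotv mulr_sumr; apply: eq_bigr => i _; rewrite mxE mulrA. Qed.

Lemma dotvDr x y z : dotv z (x + y) = dotv z x + dotv z y.
Proof. by rewrite dotvC dotvDl !(dotvC z). Qed.

Lemma dotvNr x z : dotv z (- x) = - dotv z x.
Proof. by rewrite dotvC dotvNl dotvC. Qed.

Lemma dotvZr a x z : dotv z (a *: x) = a * dotv z x.
Proof. by rewrite dotvC dotvZl dotvC. Qed.

Definition dotvE := (dotvDl, dotvNl, dotvZl, dotvDr, dotvNr, dotvZr).

Lemma enormN x : enorm (- x) = enorm x.
Proof. by rewrite /enorm !dotvE opprK. Qed.

Lemma enormB x y : enorm (x - y) = enorm (y - x).
Proof. by rewrite -enormN opprB. Qed.

Lemma enormZ a x : enorm (a *: x) = `|a| * enorm x.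
Proof. by rewrite /enorm !dotvE mulrA -expr2 sqrtrM ?sqr_ge0// sqrtr_sqr. Qed.

Lemma enorm0 : enorm (0 : 'rV[R]_n) = 0.
Proof. by rewrite -(scale0r (0 : 'rV[R]_n)) enormZ normr0 mul0r. Qed.

Lemma ler_coord_enorm x i : `|x ord0 i| <= enorm x.
Proof.
rewrite -sqrtr_sqr ler_sqrt ?dotvv_ge0// /dotv (bigD1 i)//= expr2 lerDl.
by apply: sumr_ge0 => j _; rewrite -expr2 sqr_ge0.
Qed.

Lemma enorm_eq0 x : enorm x = 0 -> x = 0.
Proof.
move=> x0; apply/rowP => i; apply/eqP; rewrite mxE -normr_le0 -x0.
exact: ler_coord_enorm.
Qed.

Lemma dotv_le_enorm x y : dotv x y <= enorm x * enorm y.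
Proof.
have [/enorm_eq0 ->|x0] := eqVneq (enorm x) 0.
  by rewrite enorm0 mul0r -(scale0r (0 : 'rV[R]_n)) dotvZl mul0r.
have [/enorm_eq0 ->|y0] := eqVneq (enorm y) 0.
  by rewrite enorm0 mulr0 -(scale0r (0 : 'rV[R]_n)) dotvZr mul0r.
have xy0 : 0 < enorm x * enorm y.
  by rewrite mulr_gt0// lt_neqAle eq_sym ?x0 ?y0 enorm_ge0.
(* Expanded, this square reads 2 |x| |y| (|x| |y| - x.y) >= 0; dividing by |x| |y| > 0 gives
   Cauchy-Schwarz. *)
have := dotvv_ge0 (enorm y *: x - enorm x *: y).
rewrite !dotvE -!sqr_enorm (dotvC y x) => h.
rewrite -(ler_pM2l xy0); nra.
Qed.

Lemma ler_enormD x y : enorm (x + y) <= enorm x + enorm y.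
Proof.
rewrite -(@ler_pXn2r _ 2)// ?nnegrE ?addr_ge0 ?enorm_ge0//.
rewrite sqr_enorm sqrrD !dotvE -!sqr_enorm (dotvC y x).
by have := dotv_le_enorm x y; lra.
Qed.

Lemma ler_enorm_tri z x y : enorm (x - y) <= enorm (x - z) + enorm (z - y).
Proof. by rewrite (le_trans _ (ler_enormD _ _))// addrA subrK. Qed.

Lemma enorm_le_sum x : enorm x <= \sum_i `|x ord0 i|.
Proof.
have s0 (P : pred 'I_n) : 0 <= \sum_(i | P i) `|x ord0 i| by exact: sumr_ge0.
rewrite -(@ler_pXn2r _ 2)// ?nnegrE ?enorm_ge0// sqr_enorm expr2 mulr_suml.
apply: ler_sum => i _; rewrite -expr2 -real_normK ?num_real// expr2.
by rewrite ler_wpM2l// (bigD1 i)//= lerDl.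
Qed.

Lemma enorm_le_norm x : enorm x <= n%:R * `|x|.
Proof.
apply: (le_trans (enorm_le_sum x)).
rewrite -[n in n%:R]card_ord -sum1_card natr_sum mulr_suml.
apply: ler_sum => i _; rewrite mul1r [leRHS]/Num.norm/= mx_normrE.
by apply/bigmax_geP; right => /=; exists (ord0, i).
Qed.

Lemma norm_le_enorm x : `|x| <= enorm x.
Proof.
rewrite [leLHS]/Num.norm/= mx_normrE; apply/bigmax_leP; split=> [|[i j] _] /=.
  exact: enorm_ge0.
by rewrite ord1 ler_coord_enorm.
Qed.

End Enorm.

Lemma measurable_enormB {R : realType} {n : nat} (x : 'rV[R]_n) :
  measurable_fun [set: 'rV[R]_n] (fun z : 'rV[R]_n => enorm (x - z)).
Proof.
rewrite /enorm /dotv.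
apply: (measurableT_comp (continuous_measurable_fun (@sqrt_continuous R))).
apply: measurable_sum => i; under eq_fun do rewrite !mxE.
by apply: measurable_funM; apply: measurable_funB => //; exact: measurable_coord.
Qed.

(** * Lebesgue measure on R^n *)

Section BorelLebesgue.
Context {R : realType}.

Lemma measurable_subrl (c : R) : measurable_fun [set: R] (fun t => c - t).
Proof. exact: measurable_funB. Qed.

(** The image measure agrees with Lebesgue measure on half-open intervals, since reflection only
    moves the open end to the other side; uniqueness of Lebesgue measure does the rest. *)
Lemma lebesgue_measure_refl (c : R) (A : set R) : measurable A ->
  lebesgue_measure ((fun t => c - t) @^-1` A) = lebesgue_measure A.
Proof.
move=> mA.
have mc : measurable_fun [set: measurableTypeR R]
    ((fun t => c - t) : measurableTypeR R -> measurableTypeR R).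
  exact: measurable_subrl.
pose nu : {measure set (measurableTypeR R) -> \bar R} :=
  pushforward lebesgue_measure
    ((fun t => c - t) : measurableTypeR R -> measurableTypeR R).
pose nu1 := nu mc.
suff H X : ocitv X -> lebesgue_measure X = nu1 X.
  by have := lebesgue_measure_unique H mA.
move=> [[a b]] _ <-; rewrite /nu1/nu/= /pushforward /=.
have -> : (fun t => c - t) @^-1` `]a, b] = `[c - b, c - a[%classic.
  apply/seteqP; split=> t /=; rewrite !in_itv/= => /andP[]; lra.
rewrite !lebesgue_measure_itv/= !lte_fin; have -> : (c - b < c - a) = (a < b).
  by apply/idP/idP; lra.
by case: ifP => // _; rewrite -!EFinB; congr EFin; lra.
Qed.

Lemma measurable_rV_refl n (c : 'rV[R]_n) :
  measurable_fun [set: 'rV[R]_n] (fun z : 'rV[R]_n => c - z).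
Proof.
apply: measurable_fun_coordP => i; under eq_fun do rewrite !mxE.
by apply: measurable_funB => //; exact: measurable_coord.
Qed.

(** Induction on the dimension: [consv] conjugates the reflection of R^(n+1) to the product [phi] of
    reflections of R and R^n, and a product measure is determined by its values on rectangles. This
    symmetry is what makes linear terms integrate to 0 over annuli. *)
Lemma borel_lebesgue_refl n (c : 'rV[R]_n) (A : set 'rV[R]_n) : measurable A ->
  borel_lebesgue R n ((fun z => c - z) @^-1` A) = borel_lebesgue R n A.
Proof.
elim: n c A => [|n IHn] c A mA.
  rewrite /= !diracE; congr (_%:R%:E); congr (nat_of_bool _); apply/idP/idP.
    by rewrite !inE/=; rewrite (_ : c - 0 = 0)//; apply/rowP; case.
  by rewrite !inE/=; rewrite (_ : c - 0 = 0)//; apply/rowP; case.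
rewrite /= /lebesgue_step /pushforward.
pose c1 := (unconsv c).1; pose c2 := (unconsv c).2.
pose T : measurableType _ := (measurableTypeR R * 'rV[R]_n)%type.
pose phi (q : T) : T := (c1 - q.1, c2 - q.2).
have mphi : measurable_fun [set: T] phi.
  apply/measurable_fun_pairP; split.
    exact: (measurableT_comp (measurable_subrl c1) measurable_fst).
  exact: (measurableT_comp (measurable_rV_refl c2) measurable_snd).
pose nu : {measure set T -> \bar R} :=
  pushforward (@lebesgue_measure R \x borel_lebesgue R n)%E phi.
pose nu1 := nu mphi.
have E : (fun z => c - z) \o @consv R n = @consv R n \o phi.
  apply/funext => q; apply/rowP => i; rewrite /= !mxE.
  case: unliftP => [j ->|->]; first by rewrite !mxE.
  by [].
rewrite -comp_preimage E comp_preimage.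
have mX : measurable (@consv R n @^-1` A).
  by rewrite -[X in measurable X]setTI; exact: measurable_consv.
suff H (X : set (measurableTypeR R)) (Y : set 'rV[R]_n) : measurable X -> measurable Y ->
    nu1 (X `*` Y) = (lebesgue_measure X * borel_lebesgue R n Y)%E.
  have := (@product_measure_unique _ _ (measurableTypeR R) 'rV[R]_n R
    lebesgue_measure (borel_lebesgue R n) nu1 H _ mX).
  by move=> /= ->.
move=> mX' mY; rewrite /nu1/nu/= /pushforward.
have -> : phi @^-1` (X `*` Y) =
   ((fun t => c1 - t) @^-1` X) `*` ((fun z => c2 - z) @^-1` Y) by [].
rewrite product_measure1E ?IHn//.
- by rewrite /= lebesgue_measure_refl.
- by rewrite -[X in measurable X]setTI; exact: measurable_subrl.
- by rewrite -[X in measurable X]setTI; exact: measurable_rV_refl.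
Qed.

(** Closed balls of the max norm. Their measure is explicit, and they bound that of Euclidean balls
    from both sides. *)
Definition box n (x : 'rV[R]_n) (r : R) : set 'rV[R]_n :=
  [set z | forall i, `|x ord0 i - z ord0 i| <= r].

Lemma measurable_box n (x : 'rV[R]_n) r : measurable (box x r).
Proof.
have -> : box x r = \bigcap_(i in [set: 'I_n])
    (fun z : 'rV[R]_n => x ord0 i - z ord0 i) @^-1` `[- r, r].
  apply/seteqP; split=> z /= h i; first by rewrite /= in_itv/= -ler_norml.
  by have := h i I; rewrite /= in_itv/= -ler_norml.
apply: fin_bigcap_measurable => // i _; rewrite -[X in measurable X]setTI.
have : measurable_fun setT (fun z : 'rV[R]_n => x ord0 i - z ord0 i).
  by apply: measurable_funB => //; exact: measurable_coord.
by apply.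
Qed.

Lemma borel_lebesgue_box n (x : 'rV[R]_n) r : 0 < r ->
  borel_lebesgue R n (box x r) = ((2 * r) ^+ n)%:E.
Proof.
move=> r0; elim: n x => [|n IHn] x.
  by rewrite /= diracE expr0 mem_set//; case.
rewrite /= /lebesgue_step /pushforward.
have -> : @consv R n @^-1` box x r =
    `[(unconsv x).1 - r, (unconsv x).1 + r]%classic `*` box (unconsv x).2 r.
  apply/seteqP; split=> -[t v] /=.
    move=> h; split.
      have := h ord0; rewrite mxE unlift_none/= in_itv/= ler_norml; lra.
    by move=> i; have := h (lift ord0 i); rewrite !mxE liftK.
  move=> [h1 h2] i; rewrite mxE; case: unliftP => [j ->|->].
    by have := h2 j; rewrite !mxE.
  by move: h1; rewrite in_itv/= ler_norml; lra.
rewrite product_measure1E ?IHn//; last exact: measurable_box.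
rewrite /= lebesgue_measure_itv/= lte_fin ltrD2l gtrN// -EFinB -EFinM exprS.
by congr (_ * _)%:E; lra.
Qed.

(** By Fubini: a line parallel to the first axis meets the sphere in at most two points. The
    truncated kernel jumps on such a sphere, so its dependence on the centre is continuous almost
    everywhere. *)
Lemma borel_lebesgue_sphere n (x : 'rV[R]_n.+1) r :
  borel_lebesgue R n.+1 [set z | enorm (x - z) = r] = 0%E.
Proof.
have mS : measurable [set z : 'rV[R]_n.+1 | enorm (x - z) = r].
  have -> : [set z | enorm (x - z) = r] =
     setT `&` (fun z : 'rV[R]_n.+1 => enorm (x - z)) @^-1` [set r].
    by rewrite setTI.
  exact: measurable_enormB.
rewrite /= /lebesgue_step /pushforward.
set A := _ @^-1` _.
have mA : measurable A.
  by rewrite -[X in measurable X]setTI; exact: measurable_consv.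
pose T : measurableType _ := (measurableTypeR R * 'rV[R]_n)%type.
(* The product taken in the other order of integration, so that the slices lie along the first
   coordinate. *)
pose nu : {measure set T -> \bar R} :=
  (@lebesgue_measure R \x^ borel_lebesgue R n)%E.
rewrite (@product_measure_unique _ _ (measurableTypeR R) 'rV[R]_n R
  lebesgue_measure (borel_lebesgue R n) nu)//=; last first.
  by move=> X Y mX mY; rewrite /nu/= product_measure2E.
apply: integral0_eq => v _ /=.
pose s := r ^+ 2 - dotv ((unconsv x).2 - v) ((unconsv x).2 - v).
pose t0 := (unconsv x).1.
have sub : ysection A v `<=` [set t0 + Num.sqrt s; t0 - Num.sqrt s].
  move=> t; rewrite /ysection/= inE /A/= => E.
  have : (t0 - t) ^+ 2 = s.
    rewrite /s -E sqr_enorm /dotv big_ord_recl !mxE unlift_none/= -expr2.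
    set a := (X in _ = _ + X - _); set b := (X in _ = _ + _ - X).
    have -> : a = b by apply: eq_bigr => i _; rewrite !mxE liftK.
    by rewrite addrK.
  move=> <-; rewrite sqrtr_sqr; have [h|h] := ger0P (t0 - t); [right|left] => /=; lra.
apply/eqP; rewrite eq_le measure_ge0 andbT.
have h0 : lebesgue_measure [set t0 + Num.sqrt s; t0 - Num.sqrt s] = 0%E.
  apply: countable_lebesgue_measure0; exact: finite_set_countable.
rewrite -h0; apply: le_measure => //; rewrite inE.
  exact: measurable_ysection.
exact: measurableU.
Qed.

End BorelLebesgue.

(** * Reflection invariance of integrals, and volumes of Euclidean balls *)

Section LebesgueRn.
Context {R : realType} {n : nat}.
Implicit Types (x z : 'rV[R]_n) (A : set 'rV[R]_n) (r : R).

Local Notation mu := (lebesgue_rV R n).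

Lemma measurable_Rn A : measurable A -> measurable (A : set (Rn R n)).
Proof. by move=> mA; apply: sub_caratheodory; exact: sub_sigma_algebra. Qed.

Lemma lebesgue_rVE A : measurable A -> mu A = borel_lebesgue R n A.
Proof. by move=> mA; rewrite /lebesgue_rV/= /completed_measure_extension measurable_mu_extE. Qed.

Lemma measurable_fun_Rn d (T : measurableType d) (f : 'rV[R]_n -> T) :
  measurable_fun [set: 'rV[R]_n] f -> measurable_fun [set: Rn R n] f.
Proof.
move=> mf _ Y mY; rewrite setTI; apply: measurable_Rn.
by rewrite -[X in measurable X]setTI; exact: mf.
Qed.

(** Both sides are integrals against image measures on the Borel sets, under the reflection and
    under the identity from [Rn R n] to its Borel version; these two measures coincide. *)
Lemma ge0_integral_rV_refl (c : 'rV[R]_n) (g : 'rV[R]_n -> \bar R) :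
  measurable_fun [set: 'rV[R]_n] g -> (forall z, 0 <= g z)%E ->
  (\int[mu]_z g (c - z)%R = \int[mu]_z g z)%E.
Proof.
move=> mg g0.
have mid : measurable_fun [set: Rn R n] (id : Rn R n -> 'rV[R]_n).
  exact: measurable_fun_Rn.
have mrefl : measurable_fun [set: Rn R n]
    ((fun z => (c - z)%R) : Rn R n -> 'rV[R]_n).
  by apply: measurable_fun_Rn; exact: measurable_rV_refl.
transitivity (\int[pushforward mu
    ((fun z => (c - z)%R) : Rn R n -> 'rV[R]_n)]_y g y)%E.
  by rewrite ge0_integral_pushforward// preimage_setT.
transitivity (\int[pushforward mu (id : Rn R n -> 'rV[R]_n)]_y g y)%E; last first.
  by rewrite ge0_integral_pushforward// preimage_setT.
apply: eq_measure_integral => //= A mA _.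
rewrite /pushforward preimage_id -!/(lebesgue_rV R n _).
rewrite [LHS]lebesgue_rVE ?[RHS]lebesgue_rVE ?borel_lebesgue_refl//.
by rewrite -[X in measurable X]setTI; exact: measurable_rV_refl.
Qed.

(** Reflection exchanges the positive and the negative part of f, so their integrals are equal. *)
Lemma Rintegral_odd0 (c : 'rV[R]_n) (f : 'rV[R]_n -> R) :
  measurable_fun [set: 'rV[R]_n] f -> (forall z, f (c - z) = - f z) ->
  \int[mu]_z f z = 0.
Proof.
move=> mf fodd; rewrite /Rintegral integralE.
have mf' : measurable_fun [set: 'rV[R]_n] (EFin \o f).
  exact/measurable_EFinP.
rewrite -[X in (_ - X)%E](@ge0_integral_rV_refl c (fun z => (EFin \o f)^\- z)%E)//; last first.
  exact: measurable_funeneg.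
have -> : (fun z => ((EFin \o f)^\- (c - z)%R)%E) = (EFin \o f)^\+%E.
  by apply/funext => z; rewrite funenegE funeposE/= fodd opprK.
(* If both parts are infinite, [fine (+oo - +oo) = 0]. *)
have : (0 <= \int[mu]_z ((EFin \o f)^\+ z))%E by exact: integral_ge0.
by case: (\int[mu]_z _)%E => [t| |]//= _; rewrite subrr.
Qed.

Definition eball x r : set 'rV[R]_n := [set z | enorm (x - z) <= r].

Lemma measurable_eball x r : measurable (eball x r).
Proof.
have -> : eball x r = setT `&` (fun z => enorm (x - z)) @^-1` `]-oo, r].
  by rewrite setTI; apply/seteqP; split=> z; rewrite /eball/= in_itv.
exact: measurable_enormB.
Qed.

Lemma lebesgue_eball_le x r : 0 < r -> (mu (eball x r) <= ((2 * r) ^+ n)%:E)%E.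
Proof.
move=> r0; rewrite -(borel_lebesgue_box x r0) -lebesgue_rVE; last exact: measurable_box.
apply: le_measure; rewrite ?inE.
- by apply: measurable_Rn; exact: measurable_eball.
- by apply: measurable_Rn; exact: measurable_box.
move=> z xz i; have := ler_coord_enorm (x - z) i; rewrite !mxE => /le_trans; exact.
Qed.

Lemma lebesgue_eball_ge x r : (0 < n)%N -> 0 < r ->
  (((2 * (r / n%:R)) ^+ n)%:E <= mu (eball x r))%E.
Proof.
move=> n0 r0; have n0' : 0 < n%:R :> R by rewrite ltr0n.
have rn : 0 < r / n%:R by rewrite divr_gt0.
rewrite -(borel_lebesgue_box x rn) -lebesgue_rVE; last exact: measurable_box.
apply: le_measure; rewrite ?inE.
- by apply: measurable_Rn; exact: measurable_box.
- by apply: measurable_Rn; exact: measurable_eball.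
move=> z xz; rewrite /eball/=; apply: (le_trans (enorm_le_sum _)).
rewrite -[leRHS](@divfK _ n%:R) ?lt0r_neq0//.
rewrite -[n in _ * n%:R]card_ord -sum1_card natr_sum mulr_sumr.
by apply: ler_sum => i _; rewrite mulr1 !mxE; exact: xz.
Qed.

Lemma lebesgue_sphere0 x r : (0 < n)%N -> mu [set z | enorm (x - z) = r] = 0%E.
Proof.
move=> n0; have mS : measurable [set z | enorm (x - z) = r].
  have -> : [set z | enorm (x - z) = r] =
     setT `&` (fun z => enorm (x - z)) @^-1` [set r] by rewrite setTI.
  exact: measurable_enormB.
rewrite lebesgue_rVE// {mS}; case: n n0 x => // m _ x.
exact: borel_lebesgue_sphere.
Qed.

End LebesgueRn.

(** * Weighted integrals of the kernel *)

Section DyadicBounds.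
Context {R : realType} {n : nat}.
Variable alpha : R.
Hypotheses (n0 : (0 < n)%N) (alpha0 : 0 < alpha) (alpha2 : alpha < 2).
Implicit Types (x z : 'rV[R]_n) (r rho : R).

Local Notation mu := (lebesgue_rV R n).
Local Notation p := (n%:R + alpha).

Lemma sum_geometric_le (q : R) m : 0 <= q -> q < 1 ->
  \sum_(k < m) q ^+ k <= (1 - q)^-1.
Proof.
move=> q0 q1; rewrite -[leRHS]mul1r ler_pdivlMr ?subr_gt0// mulrC.
by have := subrX1 q m; have := exprn_ge0 m q0; nra.
Qed.

(** f is dominated by the sum over k of [a k] times the indicator of the ball of radius [b k], whose
    k-th term has integral at most [A * q ^+ k]. It serves dyadic decompositions both towards
    infinity and towards x. *)
Lemma integral_le_geometric (f : 'rV[R]_n -> R) x (a b : nat -> R) (A q : R) :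
  measurable_fun [set: 'rV[R]_n] f -> (forall z, 0 <= f z) ->
  (forall k, 0 <= a k) -> (forall k, 0 < b k) -> 0 <= q -> q < 1 ->
  (forall k, a k * (2 * b k) ^+ n <= A * q ^+ k) ->
  (forall z, f z != 0 -> exists k, enorm (x - z) <= b k /\ f z <= a k) ->
  (\int[mu]_z (f z)%:E <= (A / (1 - q))%:E)%E.
Proof.
move=> mf f0 a0 b0 q0 q1 Aq fab.
have mB k : measurable (eball x (b k) : set (Rn R n)).
  by apply: measurable_Rn; exact: measurable_eball.
pose g k (z : Rn R n) : \bar R := (a k * \1_(eball x (b k)) z)%:E.
have g0 k z : (0 <= g k z)%E by rewrite lee_fin mulr_ge0.
have mg k : measurable_fun [set: Rn R n] (g k).
  by apply/measurable_EFinP; apply: measurable_funM.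
have Ig k : (\int[mu]_z g k z <= (A * q ^+ k)%:E)%E.
  under eq_integral do rewrite /g EFinM.
  have mI : measurable_fun [set: Rn R n] (fun z => (\1_(eball x (b k)) z : R)%:E).
    by apply/measurable_EFinP; exact: measurable_indic.
  rewrite (ge0_integralZl_EFin mu measurableT _ mI) ?a0//.
  rewrite integral_indic// setIT.
  apply: (@le_trans _ _ ((a k)%:E * ((2 * b k) ^+ n)%:E)%E).
    by rewrite lee_wpmul2l ?lee_fin ?a0// lebesgue_eball_le.
  by rewrite -EFinM lee_fin.
apply: (@le_trans _ _ (\int[mu]_z \sum_(k <oo) g k z)%E).
  apply: ge0_le_integral; first exact: measurableT.
  - by move=> z _; rewrite lee_fin.
  - by apply/measurable_EFinP; exact: measurable_fun_Rn.
  - by apply: (@ge0_emeasurable_sum _ _ _ setT g xpredT) => //.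
  move=> z _; have [->|fz] := eqVneq (f z) 0; first exact: nneseries_ge0.
  have [k [bk ak]] := fab _ fz.
  apply: (@le_trans _ _ (g k z)).
    by rewrite /g lee_fin indicE mem_set// mulr1.
  apply: (@le_trans _ _ (\sum_(0 <= i < k.+1) g i z)%E).
    by rewrite big_nat_recr//= leeDr// sume_ge0.
  exact: nneseries_lim_ge.
rewrite integral_nneseries//.
apply: lime_le; first by apply: is_cvg_nneseries => k _ _; exact: integral_ge0.
apply: nearW => m; rewrite big_mkord.
apply: (@le_trans _ _ (\sum_(k < m) (A * q ^+ k)%:E)%E).
  by apply: lee_sum => k _; exact: Ig.
rewrite sumEFin lee_fin -mulr_sumr ler_wpM2l ?sum_geometric_le//.
(* The case k = 0 shows that A is nonnegative. *)
have := Aq 0%N; rewrite expr0 mulr1; apply: le_trans.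
by rewrite mulr_ge0// exprn_ge0// mulr_ge0// ltW.
Qed.

(** Extending the truncated kernel by 0 turns every truncation into an integral over all of R^n, so
    that different centres and radii can be compared pointwise. *)
Definition tailker rho x z : R :=
  if rho < enorm (x - z) then (enorm (x - z) `^ p)^-1 else 0.

Lemma tailker_ge0 rho x z : 0 <= tailker rho x z.
Proof. by rewrite /tailker; case: ifP => // _; rewrite invr_ge0 powR_ge0. Qed.

Lemma measurable_pow_enormB x :
  measurable_fun [set: 'rV[R]_n] (fun z => (enorm (x - z) `^ p)^-1).
Proof.
under eq_fun do rewrite -powRN.
exact: (measurableT_comp (@measurable_powR R _) (measurable_enormB x)).
Qed.

Lemma measurable_tailker rho x : measurable_fun [set: 'rV[R]_n] (tailker rho x).
Proof.
apply: measurable_fun_ifT => //; last exact: measurable_pow_enormB.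
by apply: measurable_fun_ltr => //; exact: measurable_enormB.
Qed.

Lemma powR_exprn (t a : R) k : 0 <= t -> (t ^+ k) `^ a = (t `^ a) ^+ k.
Proof.
move=> t0; rewrite -(powR_mulrn k t0) -powRrM [k%:R * _]mulrC powRrM.
by rewrite powR_mulrn ?powR_ge0.
Qed.

Lemma powR_div (s t a : R) : 0 <= s -> 0 < t -> (s / t) `^ a = s `^ a / t `^ a.
Proof.
move=> s0 t0; have ta : t `^ a != 0 by rewrite gt_eqF// powR_gt0.
apply: (mulIf ta); rewrite divfK// -powRM ?divr_ge0 ?(ltW t0)//.
by rewrite divfK// gt_eqF.
Qed.

Lemma powRDn (t : R) : 0 < t -> t `^ p = t ^+ n * t `^ alpha.
Proof. by move=> t0; rewrite powRD ?powR_mulrn ?(gt_eqF t0) ?implybT// ltW. Qed.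

Lemma exists_dyadic (t s : R) : 0 < s -> s < t ->
  exists k : nat, 2 ^+ k * s < t /\ t <= 2 ^+ k.+1 * s.
Proof.
move=> s0 st.
have [m tm] : exists m : nat, t <= 2 ^+ m * s.
  exists (Num.trunc (t / s)).+1; rewrite -ler_pdivrMr//.
  have ts : 0 <= t / s by rewrite divr_ge0// ltW// (lt_trans s0).
  have /andP[_ h] := trunc_itv ts; apply: (le_trans (ltW h)).
  by rewrite -natrX ler_nat ltnW// ltn_expl.
elim: m tm => [|m IHm] tm; first by move: tm; rewrite expr0 mul1r leNgt st.
by have [/IHm//|h] := leP t (2 ^+ m * s); exists m.
Qed.

(** On the shell 2^k rho < |x - z| <= 2^(k+1) rho the kernel is at most (2^k rho)^-(n + alpha), and
    the enclosing box has volume 4^n (2^k rho)^n; the shells then sum as a geometric series of ratio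
    2^-alpha. *)
Definition cker_ub : R := 4 ^+ n / (1 - (2 `^ alpha)^-1).

Lemma powR2_gt1 (a : R) : 0 < a -> 1 < 2 `^ a.
Proof.
move=> a0; rewrite -[ltLHS]/((fun=> 1) a) -powR1.
by apply: gt0_ltr_powR => //; rewrite ?nnegrE ?ltr1n.
Qed.

Lemma cker_ub_gt0 : 0 < cker_ub.
Proof. by rewrite divr_gt0 ?exprn_gt0// subr_gt0 invf_lt1 ?powR_gt0// powR2_gt1. Qed.

Lemma integral_tailker_le rho x : 0 < rho ->
  (\int[mu]_z (tailker rho x z)%:E <= (cker_ub / rho `^ alpha)%:E)%E.
Proof.
move=> rho0; have q21 := powR2_gt1 alpha0.
have two_k k : 0 < 2 ^+ k * rho by rewrite mulr_gt0// exprn_gt0.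
have -> : cker_ub / rho `^ alpha =
    4 ^+ n / rho `^ alpha / (1 - (2 `^ alpha)^-1) by rewrite /cker_ub mulrAC.
apply: (@integral_le_geometric _ x (fun k => ((2 ^+ k * rho) `^ p)^-1)
  (fun k => 2 ^+ k.+1 * rho)).
- exact: measurable_tailker.
- exact: tailker_ge0.
- by move=> k; rewrite invr_ge0 powR_ge0.
- by move=> k; exact: two_k.
- by rewrite invr_ge0 powR_ge0.
- by rewrite invf_lt1 ?powR_gt0.
- move=> k; rewrite powRDn// powRM ?exprn_ge0 ?(ltW rho0)// powR_exprn//.
  have -> : 2 * (2 ^+ k.+1 * rho) = 4 * (2 ^+ k * rho) by rewrite exprS; ring.
  rewrite [(4 * _) ^+ n]exprMn exprVn.
  have hk : (2 ^+ k * rho) ^+ n != 0 by rewrite expf_neq0// gt_eqF.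
  rewrite le_eqVlt; apply/orP; left; apply/eqP.
  set X := (2 ^+ k * rho) ^+ n in hk *.
  have h1 : rho `^ alpha != 0 by rewrite gt_eqF// powR_gt0.
  have h2 : (2 `^ alpha) ^+ k != 0 by rewrite expf_neq0// gt_eqF// powR_gt0.
  by field; rewrite hk h1 h2.
- move=> z; rewrite /tailker; case: ifPn => [rz _|]; last by rewrite eqxx.
  have [k [h1 h2]] := exists_dyadic rho0 rz.
  exists k; split => //; rewrite lef_pV2 ?posrE ?powR_gt0//; last first.
    exact: (lt_trans rho0).
  by apply: ge0_ler_powR; rewrite ?nnegrE ?(ltW h1)// ?addr_ge0 ?(ltW alpha0) ?(ltW (two_k k)) ?enorm_ge0.
Qed.

(* The value at [z = x] is [0 / 0 = 0]. *)
Definition nearker rho x z : R :=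
  if enorm (x - z) <= rho then enorm (x - z) ^+ 2 / enorm (x - z) `^ p else 0.

Lemma nearker_ge0 rho x z : 0 <= nearker rho x z.
Proof.
by rewrite /nearker; case: ifP => // _; rewrite divr_ge0 ?powR_ge0 ?sqr_ge0.
Qed.

Lemma measurable_nearker rho x : measurable_fun [set: 'rV[R]_n] (nearker rho x).
Proof.
apply: measurable_fun_ifT => //.
  by apply: measurable_fun_ler => //; exact: measurable_enormB.
apply: measurable_funM; last exact: measurable_pow_enormB.
by apply: measurable_funX; exact: measurable_enormB.
Qed.

(** The analogous sum over shells shrinking to x: the factor |x - z|^2 makes the ratio 2^alpha / 4,
    which is below 1 because alpha < 2. *)
Definition cnear : R := 4 ^+ n.+1 / (1 - 2 `^ alpha / 4).

Lemma powR2_lt4 : 2 `^ alpha < 4 :> R.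
Proof.
have -> : 4 = 2 `^ alpha * 2 `^ (2 - alpha) :> R.
  rewrite -powRD; last by rewrite pnatr_eq0/= implybT.
  rewrite addrC subrK.
  by rewrite (powR_mulrn 2 (ler0n R 2)); lra.
by rewrite -[ltLHS]mulr1 ltr_pM2l ?powR_gt0// powR2_gt1// subr_gt0.
Qed.

Lemma cnear_gt0 : 0 < cnear.
Proof.
have := powR2_lt4 => h; rewrite divr_gt0 ?exprn_gt0//; lra.
Qed.

Lemma integral_nearker_le rho x : 0 < rho ->
  (\int[mu]_z (nearker rho x z)%:E <= (cnear * rho ^+ 2 / rho `^ alpha)%:E)%E.
Proof.
move=> rho0; have q4 := powR2_lt4; have q0 : 0 < 2 `^ alpha :> R by rewrite powR_gt0.
have hk k : 0 < rho / 2 ^+ k by rewrite divr_gt0// exprn_gt0.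
have -> : cnear * rho ^+ 2 / rho `^ alpha =
    4 ^+ n.+1 * rho ^+ 2 / rho `^ alpha / (1 - 2 `^ alpha / 4).
  by rewrite /cnear; ring.
apply: (@integral_le_geometric _ x
  (fun k => (2 * (rho / 2 ^+ k)) ^+ 2 / (rho / 2 ^+ k) `^ p)
  (fun k => 2 * (rho / 2 ^+ k))).
- exact: measurable_nearker.
- exact: nearker_ge0.
- by move=> k; rewrite divr_ge0 ?powR_ge0 ?sqr_ge0.
- by move=> k; rewrite mulr_gt0.
- by rewrite divr_ge0// ltW.
- lra.
- move=> k; rewrite powRDn// powR_div ?(ltW rho0) ?exprn_gt0// powR_exprn//.
  have -> : 2 * (2 * (rho / 2 ^+ k)) = 4 * (rho / 2 ^+ k) by ring.
  rewrite [(4 * _) ^+ n]exprMn; set X := (rho / 2 ^+ k) ^+ n.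
  rewrite [(_ / 4) ^+ k]expr_div_n.
  have X0 : X != 0 by rewrite expf_neq0// gt_eqF.
  have r1 : rho `^ alpha != 0 by rewrite gt_eqF// powR_gt0.
  have r2 : (2 `^ alpha) ^+ k != 0 by rewrite expf_neq0// gt_eqF.
  have r3 : 2 ^+ k != 0 :> R by rewrite expf_neq0.
  have -> : 4 ^+ k = 2 ^+ k * 2 ^+ k :> R by rewrite -exprMn; congr (_ ^+ _); lra.
  rewrite le_eqVlt; apply/orP; left; apply/eqP; rewrite [4 ^+ n.+1]exprS.
  by field; rewrite X0 r1 r2 r3.
- move=> z; rewrite /nearker; case: ifPn => [zr|]; last by rewrite eqxx.
  have [z0|z0 _] := eqVneq (enorm (x - z)) 0.
    by rewrite z0 expr0n/= mul0r eqxx.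
  have z1 : 0 < enorm (x - z) by rewrite lt_neqAle eq_sym z0 enorm_ge0.
  (* Comparing with 2 rho instead of rho keeps the strict inequality asked by [exists_dyadic] when
     |x - z| = rho; it yields rho / 2^k <= |x - z| <= 2 rho / 2^k. *)
  have [k [h1 h2]] : exists k : nat, 2 ^+ k * enorm (x - z) < 2 * rho /\
      2 * rho <= 2 ^+ k.+1 * enorm (x - z).
    by apply: exists_dyadic => //; lra.
  have k0 : 0 < 2 ^+ k :> R by rewrite exprn_gt0.
  have h3 : enorm (x - z) <= 2 * (rho / 2 ^+ k).
    by rewrite mulrA ler_pdivlMr// mulrC ltW.
  have h4 : rho / 2 ^+ k <= enorm (x - z).
    by rewrite ler_pdivrMr//; move: h2; rewrite exprS; lra.
  exists k; split => //; apply: ler_pM; rewrite ?sqr_ge0 ?invr_ge0 ?powR_ge0//.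
    by rewrite ler_pXn2r ?nnegrE ?enorm_ge0 ?mulr_ge0 ?(ltW rho0).
  rewrite lef_pV2 ?posrE ?powR_gt0//.
  by apply: ge0_ler_powR; rewrite ?nnegrE ?addr_ge0 ?(ltW alpha0) ?(ltW (hk k)) ?enorm_ge0.
Qed.

End DyadicBounds.
Arguments cker_ub {R} n alpha.
Arguments cnear {R} n alpha.

(** * Kernels that can be integrated against every function of L_alpha *)

Section WeightedIntegrals.
Context {R : realType} {n : nat}.
Variable alpha : R.
Hypotheses (n0 : (0 < n)%N) (alpha0 : 0 < alpha) (alpha2 : alpha < 2).
Implicit Types (x y z : 'rV[R]_n) (r rho : R) (u v w g h : 'rV[R]_n -> R).

Local Notation mu := (lebesgue_rV R n).
Local Notation p := (n%:R + alpha).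
Local Notation tailker := (tailker alpha).

(** The decay matches the denominator in [L_alpha], so that v g is integrable for every v in
    [L_alpha]. *)
Definition weight g := measurable_fun [set: 'rV[R]_n] g /\
  exists C, forall z, `|g z| <= C / (1 + enorm z `^ p).

Definition wint v g : R := \int[mu]_z (v z * g z).

Lemma p_gt0 : 0 < p.
Proof. by rewrite ltr_wpDl. Qed.

Lemma measurable_1Dpow_enorm :
  measurable_fun [set: 'rV[R]_n] (fun z => 1 + enorm z `^ p).
Proof.
apply: measurable_funD => //.
have := measurable_enormB (0 : 'rV[R]_n).
under eq_fun do rewrite sub0r enormN.
by move=> me; exact: (measurableT_comp (@measurable_powR R _) me).
Qed.

Lemma weight_integrable v g : L_alpha alpha v -> weight g ->
  mu.-integrable setT (EFin \o (fun z => v z * g z)).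
Proof.
move=> [mv iv] [mg [C gC]].
have den_gt0 z : 0 < 1 + enorm z `^ p by rewrite ltr_wpDr ?powR_ge0.
have md : measurable_fun [set: Rn R n] (fun z : Rn R n => 1 + enorm z `^ p).
  exact: (measurable_fun_Rn measurable_1Dpow_enorm).
have mvg : measurable_fun [set: Rn R n] (fun z => v z * g z).
  exact: (measurable_funM mv (measurable_fun_Rn mg)).
have mvd : measurable_fun [set: Rn R n]
    (fun z : Rn R n => `|v z| / (1 + enorm z `^ p)).
  apply: measurable_funM; first exact: measurableT_comp.
  by under eq_fun do rewrite -powR_inv1 ?(ltW (den_gt0 _))//;
    exact: (measurableT_comp (@measurable_powR R _) md).
have i1 : mu.-integrable setT
    (EFin \o (fun z : Rn R n => `|v z| / (1 + enorm z `^ p))).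
  apply/integrableP; split; first exact/measurable_EFinP.
  rewrite (_ : (\int[_]_x _)%E = (\int[mu]_x (`|v x| / (1 + enorm x `^ p))%:E)%E)//.
  by apply: eq_integral => z _ /=; rewrite ger0_norm// divr_ge0// ltW.
have i2 := integrableZl measurableT C i1.
apply: (le_integrable measurableT _ _ i2); first exact/measurable_EFinP.
move=> z _ /=; rewrite lee_fin normrM.
rewrite [leRHS](_ : _ = `|v z| * (`|C| / (1 + enorm z `^ p))); last first.
  by rewrite normrM [X in _ * X]ger0_norm ?divr_ge0// ?ltW//; ring.
rewrite ler_wpM2l// (le_trans (gC z))// ler_wpM2r ?invr_ge0 ?ler_norm//.
exact: ltW.
Qed.

Lemma L_alphaP v : measurable_fun [set: Rn R n] v ->
  mu.-integrable setT
    (EFin \o (fun z : Rn R n => v z * (1 + enorm z `^ p)^-1)) ->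
  L_alpha alpha v.
Proof.
move=> mv /integrableP[_ ib]; split => //; apply: le_lt_trans ib.
rewrite le_eqVlt; apply/orP; left; apply/eqP; apply: eq_integral => z _ /=.
by rewrite normrM [`|_^-1|]ger0_norm// invr_ge0 addr_ge0 ?powR_ge0.
Qed.

Lemma weight_le g h : measurable_fun [set: 'rV[R]_n] g -> weight h ->
  (forall z, `|g z| <= `|h z|) -> weight g.
Proof.
by move=> mg [_ [C hC]] gh; split=> //; exists C => z; exact: le_trans (hC z).
Qed.

Lemma weight_scale a g : weight g -> weight (fun z => a * g z).
Proof.
move=> [mg [C gC]]; split; first exact: measurable_funM.
by exists (`|a| * C) => z; rewrite normrM -mulrA ler_wpM2l.
Qed.

Lemma weight_add g h : weight g -> weight h -> weight (fun z => g z + h z).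
Proof.
move=> [mg [C gC]] [mh [D hD]]; split; first exact: measurable_funD.
by exists (C + D) => z; rewrite mulrDl (le_trans (ler_normD _ _))// lerD.
Qed.

(** Where D = |x - z| > rho, one has |z| <= |x| + D <= (|x| / rho + 1) D; hence 1 + |z|^p is at most
    a constant times D^p. *)
Lemma weight_tailker rho x : 0 < rho -> weight (tailker rho x).
Proof.
move=> rho0; split; first exact: measurable_tailker.
have p0 := p_gt0; set M := enorm x / rho + 1.
have M0 : 0 <= M by rewrite addr_ge0// divr_ge0 ?enorm_ge0// ltW.
exists ((rho `^ p)^-1 + M `^ p) => z; rewrite ger0_norm ?tailker_ge0// /tailker.
have den_gt0 : 0 < 1 + enorm z `^ p by rewrite ltr_wpDr ?powR_ge0.
have r0 : 0 < rho `^ p by rewrite powR_gt0.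
case: ifPn => [rz|_]; last first.
  by rewrite divr_ge0 ?(ltW den_gt0)// addr_ge0 ?powR_ge0// invr_ge0 ltW.
set D := enorm (x - z) in rz *.
have D0 : 0 < D by exact: lt_trans rz.
have Dp : 0 < D `^ p by rewrite powR_gt0.
rewrite ler_pdivlMr// mulrC ler_pdivrMr// mulrDl.
apply: lerD.
  rewrite mulrC ler_pdivlMr// mul1r; apply: ge0_ler_powR.
  - exact: ltW.
  - by rewrite nnegrE ltW.
  - by rewrite nnegrE ltW.
  - exact: ltW.
rewrite -powRM ?(ltW D0)//; apply: ge0_ler_powR.
- exact: ltW.
- by rewrite nnegrE enorm_ge0.
- by rewrite nnegrE mulr_ge0// ltW.
have h1 : enorm z <= enorm x + D.
  have := ler_enormD x (z - x); rewrite addrC subrK enormB; exact.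
have h2 : enorm x <= enorm x / rho * D.
  by rewrite mulrAC ler_pdivlMr// ler_wpM2l ?enorm_ge0// ltW.
by rewrite /M mulrDl mul1r; lra.
Qed.

End WeightedIntegrals.

(** * Linearity and monotonicity of weighted integrals; tails and their size *)

Section TailIntegrals.
Context {R : realType} {n : nat}.
Variable alpha : R.
Hypotheses (n0 : (0 < n)%N) (alpha0 : 0 < alpha) (alpha2 : alpha < 2).
Implicit Types (x y z : 'rV[R]_n) (r rho : R) (u v w g h : 'rV[R]_n -> R).

Local Notation mu := (lebesgue_rV R n).
Local Notation p := (n%:R + alpha).
Local Notation tailker := (tailker alpha).
Local Notation nearker := (nearker alpha).
Local Notation weight := (weight alpha).
Local Notation L_alpha := (L_alpha alpha).

Let base (z : 'rV[R]_n) : R := (1 + enorm z `^ p)^-1.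

Let base_gt0 z : 0 < base z.
Proof. by rewrite invr_gt0 ltr_wpDr ?powR_ge0. Qed.

Let measurable_base : measurable_fun [set: 'rV[R]_n] base.
Proof.
rewrite /base; under eq_fun do rewrite -powR_inv1 ?addr_ge0 ?powR_ge0//.
exact: (measurableT_comp (@measurable_powR R _) (measurable_1Dpow_enorm alpha)).
Qed.

Let weight_base : weight base.
Proof.
split=> //; exists 1 => z.
by rewrite div1r ger0_norm// ltW.
Qed.

Lemma L_alphaD v w : L_alpha v -> L_alpha w -> L_alpha (fun z => v z + w z).
Proof.
move=> Lv Lw; have := integrableD measurableT (weight_integrable Lv weight_base)
  (weight_integrable Lw weight_base).
move=> ivw; apply: L_alphaP.
  by apply: measurable_funD; [case: Lv|case: Lw].
apply: eq_integrable ivw => // z _ /=.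
by rewrite -EFinD mulrDl.
Qed.

Lemma L_alphaZ a v : L_alpha v -> L_alpha (fun z => a * v z).
Proof.
move=> Lv; have iv := integrableZl measurableT a (weight_integrable Lv weight_base).
apply: L_alphaP; first by case: Lv => mv _; exact: measurable_funM.
by apply: eq_integrable iv => // z _ /=; rewrite -EFinM mulrA.
Qed.

Lemma L_alpha_norm v : L_alpha v -> L_alpha (fun z => `|v z|).
Proof.
move=> [mv iv]; split; first exact: measurableT_comp.
by under eq_integral do rewrite normr_id.
Qed.

Lemma L_alpha_cst c : L_alpha (fun _ : 'rV[R]_n => c).
Proof.
have [mt _] := @weight_tailker R n alpha alpha0 1 0 ltr01.
suff L1 : L_alpha (fun _ : 'rV[R]_n => 1).
  have := L_alphaZ c L1; rewrite (_ : (fun z => _) = (fun=> c))//.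
  by apply/funext => z; rewrite mulr1.
split; first exact: measurable_cst.
have mB : measurable (eball (0 : 'rV[R]_n) 1 : set (Rn R n)).
  by apply: measurable_Rn; exact: measurable_eball.
(* The integrand 1 / (1 + |z|^p) is at most 1 on the unit ball and at most |z|^-p outside it. *)
apply: (@le_lt_trans _ _ (\int[mu]_z ((\1_(eball 0 1) z)%:E + (tailker 1 0 z)%:E))%E).
  apply: ge0_le_integral; first exact: measurableT.
  - by move=> z _; rewrite lee_fin divr_ge0// addr_ge0 ?powR_ge0.
  - apply/measurable_EFinP; apply: measurable_fun_Rn.
    by apply: measurable_funM => //; exact: measurable_base.
  - apply: emeasurable_funD; apply/measurable_EFinP; last exact: measurable_fun_Rn.
    exact: measurable_indic.
  move=> z _; rewrite -EFinD lee_fin normr1 div1r indicE /tailker.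
  have e0 : enorm (0 - z) = enorm z by rewrite sub0r enormN.
  have [zB|zB] := boolP (z \in eball 0 1).
    rewrite -[leLHS]addr0 lerD//; last exact: tailker_ge0.
    by rewrite invf_le1 ?lerDl ?powR_ge0// ltr_wpDr ?powR_ge0.
  have z1 : 1 < enorm z.
    by rewrite ltNge; apply: contra zB => zB; rewrite inE /eball/= e0.
  rewrite e0 z1 add0r lef_pV2 ?posrE ?ltr_wpDr ?powR_ge0 ?lerDr//.
  by rewrite powR_gt0// (lt_trans _ z1).
have mI : measurable_fun [set: Rn R n] (fun z => (\1_(eball 0 1) z : R)%:E).
  by apply/measurable_EFinP; exact: measurable_indic.
have mT : measurable_fun [set: Rn R n] (fun z => (tailker 1 0 z)%:E).
  by apply/measurable_EFinP; exact: measurable_fun_Rn.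
rewrite (ge0_integralD mu measurableT _ mI _ mT); last 2 first.
- by move=> z _; rewrite lee_fin.
- by move=> z _; rewrite lee_fin tailker_ge0.
rewrite integral_indic// setIT lte_add_pinfty//.
  by rewrite (le_lt_trans (lebesgue_eball_le _ _))// ltry.
by rewrite (le_lt_trans (integral_tailker_le _ _ _))// ltry.
Qed.

Lemma wint_le v w g h : L_alpha v -> L_alpha w -> weight g -> weight h ->
  (forall z, v z * g z <= w z * h z) -> wint v g <= wint w h.
Proof.
move=> Lv Lw Wg Wh vw; apply: le_Rintegral => //.
- exact: weight_integrable Lv Wg.
- exact: weight_integrable Lw Wh.
Qed.

Lemma wint_ge0 v g : (forall z, 0 <= v z) -> (forall z, 0 <= g z) ->
  0 <= wint v g.
Proof. by move=> v0 g0; apply: Rintegral_ge0 => z _; rewrite mulr_ge0. Qed.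

Lemma wintDl v w g : L_alpha v -> L_alpha w -> weight g ->
  wint (fun z => v z + w z) g = wint v g + wint w g.
Proof.
move=> Lv Lw Wg; rewrite /wint; under eq_Rintegral do rewrite mulrDl.
by rewrite RintegralD//; [exact: weight_integrable Lv Wg|exact: weight_integrable Lw Wg].
Qed.

Lemma wintZl a v g : L_alpha v -> weight g ->
  wint (fun z => a * v z) g = a * wint v g.
Proof.
move=> Lv Wg; rewrite /wint; under eq_Rintegral do rewrite -mulrA.
by rewrite RintegralZl//; exact: weight_integrable Lv Wg.
Qed.

Lemma wintDr v g h : L_alpha v -> weight g -> weight h ->
  wint v (fun z => g z + h z) = wint v g + wint v h.
Proof.
move=> Lv Wg Wh; rewrite /wint; under eq_Rintegral do rewrite mulrDr.
by rewrite RintegralD//; [exact: weight_integrable Lv Wg|exact: weight_integrable Lv Wh].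
Qed.

Lemma wintZr a v g : L_alpha v -> weight g ->
  wint v (fun z => a * g z) = a * wint v g.
Proof.
move=> Lv Wg; rewrite /wint; under eq_Rintegral do rewrite mulrCA.
by rewrite RintegralZl//; exact: weight_integrable Lv Wg.
Qed.

(** Since |x' - z| <= c |x - z| wherever the left kernel is nonzero, raising to the power -p costs a
    factor c^p. All changes of centre and radius below go through this comparison. *)
Lemma tailker_le c x x' rho rho' z : 0 <= c -> 0 <= rho -> 0 <= rho' ->
  (rho < enorm (x - z) ->
    rho' < enorm (x' - z) /\ enorm (x' - z) <= c * enorm (x - z)) ->
  tailker rho x z <= c `^ p * tailker rho' x' z.
Proof.
move=> c0 rho0 rho0' H; rewrite {1}/tailker; case: ifPn => [h|_]; last first.
  by rewrite mulr_ge0 ?powR_ge0 ?tailker_ge0.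
have [h1 h2] := H h; rewrite /tailker h1.
have e0 : 0 < enorm (x - z) by exact: le_lt_trans h.
have e0' : 0 < enorm (x' - z) by exact: le_lt_trans h1.
rewrite ler_pdivlMr ?powR_gt0// mulrC ler_pdivrMr ?powR_gt0//.
rewrite -powRM ?(ltW e0)//; apply: ge0_ler_powR => //.
- exact/ltW/p_gt0.
- by rewrite nnegrE ltW.
- by rewrite nnegrE mulr_ge0// ltW.
Qed.

(** The m(x, rho) of the overview; [ktail] is k(x, rho), which is controlled from both sides by
    multiples of rho^-alpha. *)
Definition tail v rho x := wint v (tailker rho x).

Definition ktail rho x : R := tail (fun=> 1) rho x.

(** A ball of radius rho / 2 centred at distance 2 rho from x lies in rho < |x - z| < 3 rho and
    contains a box of volume (rho / n)^n; integrating (3 rho)^-p over that box gives clow /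
    rho^alpha. *)
Definition clow : R := (3 `^ p * n%:R ^+ n)^-1.

Lemma clow_gt0 : 0 < clow.
Proof. by rewrite invr_gt0 mulr_gt0 ?powR_gt0// exprn_gt0// ltr0n. Qed.

Lemma EFin_ktail rho x : 0 < rho ->
  (ktail rho x)%:E = (\int[mu]_z (tailker rho x z)%:E)%E.
Proof.
move=> rho0; rewrite /ktail /tail /wint; under eq_Rintegral do rewrite mul1r.
rewrite /Rintegral fineK// ge0_fin_numE; last first.
  by apply: integral_ge0 => z _; rewrite lee_fin tailker_ge0.
by rewrite (le_lt_trans (integral_tailker_le _ _ _))// ltry.
Qed.

Lemma ktail_le rho x : 0 < rho -> ktail rho x <= cker_ub n alpha / rho `^ alpha.
Proof. by move=> rho0; rewrite -lee_fin EFin_ktail// integral_tailker_le. Qed.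

Lemma ktail_ge rho x : 0 < rho -> clow / rho `^ alpha <= ktail rho x.
Proof.
move=> rho0; rewrite -lee_fin EFin_ktail//.
pose y : 'rV[R]_n := x + (2 * rho) *: delta_mx ord0 (Ordinal n0).
have xy : enorm (x - y) = 2 * rho.
  rewrite /y opprD addrA subrr sub0r enormN enormZ ger0_norm; last by rewrite mulr_ge0// ltW.
  rewrite /enorm /dotv (bigD1 (Ordinal n0))//= big1 ?addr0 ?mxE ?eqxx ?mulr1 ?sqrtr1 ?mulr1//.
  by move=> i /negbTE i0; rewrite !mxE i0 andbF mulr0.
have mB : measurable (eball y (rho / 2) : set (Rn R n)).
  by apply: measurable_Rn; exact: measurable_eball.
have mI : measurable_fun [set: Rn R n] (fun z => (\1_(eball y (rho / 2)) z : R)%:E).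
  by apply/measurable_EFinP; exact: measurable_indic.
have r3 : 0 < (3 * rho) `^ p by rewrite powR_gt0// mulr_gt0.
apply: (@le_trans _ _ (\int[mu]_z (((3 * rho) `^ p)^-1%:E *
    (\1_(eball y (rho / 2)) z)%:E))%E).
  rewrite (ge0_integralZl_EFin mu measurableT _ mI) ?invr_ge0 ?(ltW r3)//.
  rewrite integral_indic// setIT.
  have r2 : 0 < rho / 2 by rewrite divr_gt0.
  apply: le_trans (_ : (((3 * rho) `^ p)^-1%:E * ((2 * (rho / 2 / n%:R)) ^+ n)%:E <= _)%E); last first.
    by rewrite lee_wpmul2l ?lee_fin ?invr_ge0 ?(ltW r3)// lebesgue_eball_ge.
  rewrite -EFinM lee_fin le_eqVlt; apply/orP; left; apply/eqP.
  rewrite powRM// ?(ltW rho0)// [rho `^ p]powRDn// /clow.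
  have -> : 2 * (rho / 2 / n%:R) = rho / n%:R by field; rewrite pnatr_eq0 -lt0n.
  rewrite expr_div_n.
  have h1 : rho ^+ n != 0 by rewrite expf_neq0// gt_eqF.
  have h2 : rho `^ alpha != 0 by rewrite gt_eqF// powR_gt0.
  have h3 : 3 `^ p != 0 by rewrite gt_eqF// powR_gt0.
  have h4 : n%:R ^+ n != 0 :> R by rewrite expf_neq0// pnatr_eq0 -lt0n.
  by field; rewrite h1 h2 h3 h4.
apply: ge0_le_integral; first exact: measurableT.
- by move=> z _; rewrite mule_ge0 ?lee_fin// invr_ge0 ltW.
- by apply: emeasurable_funM => //; exact: mI.
- by apply/measurable_EFinP; apply: measurable_fun_Rn; exact: measurable_tailker.
move=> z _; rewrite -EFinM lee_fin indicE.
have [|_] := boolP (z \in _); last by rewrite mulr0 tailker_ge0.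
rewrite inE /eball/= mulr1 => yz; have := ler_enorm_tri y x z.
have := ler_enorm_tri z x y; rewrite xy (enormB z y) => h1 h2.
have h3 : rho < enorm (x - z) by lra.
rewrite /tailker h3 lef_pV2 ?posrE//; last by rewrite powR_gt0// (lt_trans rho0).
apply: ge0_ler_powR; rewrite ?nnegrE ?enorm_ge0 ?mulr_ge0 ?(ltW rho0)//.
- exact/ltW/p_gt0.
- lra.
Qed.

Lemma ktail_gt0 rho x : 0 < rho -> 0 < ktail rho x.
Proof.
move=> rho0; apply: lt_le_trans (ktail_ge _ rho0).
by rewrite divr_gt0 ?clow_gt0// powR_gt0.
Qed.

Lemma truncated_integralE u x rho : 0 < rho -> L_alpha u ->
  truncated_integral alpha u x rho = u x * ktail rho x - tail u rho x.
Proof.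
move=> rho0 Lu; rewrite /truncated_integral Rintegral_mkcond.
have W := @weight_tailker R n alpha alpha0 rho x rho0.
have L1 : L_alpha (fun _ : 'rV[R]_n => u x) := L_alpha_cst _.
have -> : u x * ktail rho x - tail u rho x = wint (fun z => u x - u z) (tailker rho x).
  rewrite /ktail /tail -(wintZl _ (L_alpha_cst 1) W).
  have -> : (fun z => u x - u z) = (fun z => u x * 1 + (-1) * u z).
    by apply/funext => z; rewrite mulr1 mulN1r.
  rewrite (wintDl (L_alphaZ _ (L_alpha_cst 1)) (L_alphaZ (-1) Lu) W).
  by rewrite (wintZl (-1) Lu W) mulN1r.
apply: eq_Rintegral => z _; rewrite /pv_integrand /tailker patchE.
have [h|h] := boolP (z \in far x rho).
  by move: h; rewrite inE /far/= => ->.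
have -> : (rho < enorm (x - z)) = false; last by rewrite mulr0.
by apply/negbTE; apply: contra h => h; rewrite inE /far.
Qed.

End TailIntegrals.

(** * Touching by paraboloids *)

Section EnormTopology.
Context {R : realType} {n : nat}.
Implicit Types (x y z : 'rV[R]_n) (f : 'rV[R]_n -> R).

Lemma nbhs_enormP x (A : set 'rV[R]_n) : nbhs x A <->
  exists2 d : R, 0 < d & forall t, enorm (x - t) <= d -> A t.
Proof.
split=> [/nbhs_normP[d /= d0 dP]|[d d0 dP]].
  exists (d / 2) => [|t xt]; first by rewrite divr_gt0.
  apply: dP => /=; apply: le_lt_trans (norm_le_enorm _) _.
  by apply: (le_lt_trans xt); lra.
have n1 : 0 < n%:R + 1 :> R by rewrite ltr_wpDl.
apply/(@nbhs_normP R ('rV[R]_n) x).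
exists (d / (n%:R + 1)) => [|t /= xt] /=; first by rewrite divr_gt0.
apply: dP; apply: le_trans (enorm_le_norm _) _.
move: xt; rewrite ltr_pdivlMr// => xt.
by have := normr_ge0 (x - t); nra.
Qed.

Lemma continuous_enormP f z : {for z, continuous f} <->
  forall e : R, 0 < e -> exists2 d : R, 0 < d &
    forall t, enorm (z - t) <= d -> `|f z - f t| <= e.
Proof.
split=> [fz e e0|H].
  by move/cvgrPdist_le : fz => /(_ e e0) /nbhs_enormP.
apply/(@cvgrPdist_le _ _ _ (nbhs (z : 'rV[R]_n)) _ f (f z)).
by move=> e e0; apply/nbhs_enormP; exact: H.
Qed.

Lemma continuous_enormB x z : {for z, continuous (fun z => enorm (x - z))}.
Proof.
apply/continuous_enormP => e e0; exists e => // t zt.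
have h1 := ler_enorm_tri z x t; have h2 := ler_enorm_tri t x z.
by rewrite ler_norml; rewrite (enormB t) in h2; lra.
Qed.

Lemma continuous_sub_sqr x (K : R) f z : {for z, continuous f} ->
  {for z, continuous (fun z => f z - K * enorm (x - z) ^+ 2)}.
Proof.
move=> cf; have ce := @continuous_enormB x z.
exact: (cvgB cf (cvgM (cvg_cst K) (cvgM ce ce))).
Qed.

Lemma continuous_mul_exp x (r : R) k f z : {for z, continuous f} ->
  {for z, continuous (fun z => f z * (r - enorm (x - z)) ^+ k)}.
Proof.
move=> cf; have ce := @continuous_enormB x z.
have c1 : {for z, continuous (fun t : 'rV[R]_n => r - enorm (x - t))}.
  exact: (cvgB (cvg_cst r) ce).
have c2 : {for z, continuous ((fun s : R => s ^+ k) \o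
    (fun t : 'rV[R]_n => r - enorm (x - t)))}.
  by apply: (continuous_comp c1); exact: exprn_continuous.
exact: (cvgM cf c2).
Qed.

Lemma eball_compact x r : compact (eball x r).
Proof.
apply: bounded_closed_compact.
  exists (enorm x + r); split; first exact: num_real.
  move=> M hM z zr /=; apply: le_trans (norm_le_enorm _) _.
  have := ler_enorm_tri x z 0; rewrite !subr0 (enormB z) => h.
  by apply: (le_trans h); move: zr; rewrite /eball/=; lra.
have -> : eball x r = (fun z => enorm (x - z)) @^-1` [set t | t <= r] by [].
apply: closed_comp; last exact: closed_le.
by move=> z _; exact: continuous_enormB.
Qed.

Lemma eball_max x r f : 0 <= r ->
  (forall z, enorm (x - z) <= r -> {for z, continuous f}) ->
  exists2 c, enorm (x - c) <= r & forall z, enorm (x - z) <= r -> f z <= f c.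
Proof.
move=> r0 cf.
have [||c cr cmax] := @EVT_max_rV R n f (eball x r) _ (@eball_compact x r).
- by exists x; rewrite /eball/= subrr enorm0.
- by apply: continuous_in_subspaceT => z; rewrite inE => /cf.
exists c; first by move: cr; rewrite inE.
by move=> z zr; apply: cmax; rewrite inE.
Qed.

End EnormTopology.

(** * Residuals, fractional harmonicity, and the effect of a touching paraboloid *)

Section Touching.
Context {R : realType} {n : nat}.
Variable alpha : R.
Hypotheses (n0 : (0 < n)%N) (alpha0 : 0 < alpha) (alpha2 : alpha < 2).
Implicit Types (x y z b : 'rV[R]_n) (r rho : R) (u v w g h : 'rV[R]_n -> R).

Local Notation mu := (lebesgue_rV R n).
Local Notation p := (n%:R + alpha).
Local Notation tailker := (tailker alpha).
Local Notation nearker := (nearker alpha).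
Local Notation weight := (weight alpha).
Local Notation L_alpha := (L_alpha alpha).
Local Notation tail := (tail alpha).
Local Notation ktail := (ktail alpha).
Local Notation cnear := (cnear n alpha).

(** The I(x, rho) of the overview; it equals [truncated_integral] by [truncated_integralE]. *)
Definition resid v rho x := v x * ktail rho x - tail v rho x.

(** No sign is imposed, so the class is stable under v -> - v, used to touch from below, and under
    adding constants, used for u - inf u. *)
Definition fharmonic v := L_alpha v /\
  forall x, resid v rho x @[rho --> 0^'+] --> 0.

Lemma residE v rho x : 0 < rho -> L_alpha v ->
  resid v rho x = wint (fun z => v x - v z) (tailker rho x).
Proof.
move=> rho0 Lv; have W := @weight_tailker R n alpha alpha0 rho x rho0.
have L1 := L_alpha_cst alpha0 (1 : R) : L_alpha (fun _ : 'rV[R]_n => 1).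
rewrite /resid /ktail /tail -(wintZl (v x) L1 W).
have -> : (fun z => v x - v z) = (fun z => v x * 1 + (-1) * v z).
  by apply/funext => z; rewrite mulr1 mulN1r.
rewrite (wintDl (L_alphaZ _ L1) (L_alphaZ (-1) Lv) W).
by rewrite (wintZl (-1) Lv W) mulN1r.
Qed.

Lemma abs_dotv_le b y : `|dotv b y| <= enorm b * enorm y.
Proof.
rewrite ler_norml dotv_le_enorm andbT lerNl -dotvNl -(enormN b).
exact: dotv_le_enorm.
Qed.

Section shell.
Variables (x : 'rV[R]_n) (e rho : R).
Hypotheses (e0 : 0 < e) (erho : e <= rho).

Let shell z := tailker e x z - tailker rho x z.

Let shellE z : shell z =
  if (e < enorm (x - z)) && (enorm (x - z) <= rho)
  then (enorm (x - z) `^ p)^-1 else 0.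
Proof.
rewrite /shell /tailker leNgt.
case: (ltP rho) => [h|h] /=; first by rewrite (le_lt_trans erho h) subrr.
by rewrite andbT subr0.
Qed.

Let shell_ge0 z : 0 <= shell z.
Proof. by rewrite shellE; case: ifP => // _; rewrite invr_ge0 powR_ge0. Qed.

Let shell_le z : shell z <= tailker e x z.
Proof. by rewrite lerBlDr lerDl tailker_ge0. Qed.

Let measurable_shell : measurable_fun [set: 'rV[R]_n] shell.
Proof. by apply: measurable_funB; exact: measurable_tailker. Qed.

Let weight_shell : weight shell.
Proof.
apply: weight_le (weight_tailker alpha0 x e0) _ => // z.
by rewrite !ger0_norm ?tailker_ge0.
Qed.

Let shell_scaled g c : measurable_fun [set: 'rV[R]_n] g -> 0 <= c ->
  (forall z, enorm (x - z) <= rho -> `|g z| <= c) ->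
  weight (fun z => g z * shell z).
Proof.
move=> mg c0 gc; apply: weight_le (weight_scale c weight_shell) _.
  exact: measurable_funM.
move=> z; rewrite !normrM (ger0_norm c0) [`|shell z|]ger0_norm// shellE.
case: ifPn => [/andP[_ h]|_]; last by rewrite !mulr0.
by rewrite ler_wpM2r ?gc// invr_ge0 powR_ge0.
Qed.

(** The reflection z -> 2 x - z preserves the annulus and changes the sign of b . (z - x). *)
Lemma shell_linear b :
  weight (fun z => dotv b (z - x) * shell z) /\
  wint (fun=> 1) (fun z => dotv b (z - x) * shell z) = 0.
Proof.
have md : measurable_fun [set: 'rV[R]_n] (fun z => dotv b (z - x)).
  rewrite /dotv; apply: measurable_sum => i; under eq_fun do rewrite !mxE.
  by apply: measurable_funM => //; apply: measurable_funB => //; exact: measurable_coord.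
split.
  apply: (@shell_scaled _ (enorm b * rho)) => //.
    by rewrite mulr_ge0 ?enorm_ge0// (le_trans (ltW e0)).
  move=> z xz; apply: (le_trans (abs_dotv_le _ _)).
  by rewrite enormB ler_wpM2l ?enorm_ge0.
rewrite /wint; apply: (@Rintegral_odd0 R n (2 *: x)
  (fun z => 1 * (dotv b (z - x) * shell z))).
  by apply: measurable_funM => //; exact: measurable_funM.
move=> z; have E : dotv b (2 *: x - z - x) = - dotv b (z - x).
  rewrite -dotvNr opprB; congr (dotv b _).
  by rewrite scaler_nat mulr2n addrAC -(addrA x x) subrr addr0.
have S : shell (2 *: x - z) = shell z.
  rewrite /shell /tailker.
  have -> // : enorm (x - (2 *: x - z)) = enorm (x - z).
  rewrite opprB addrCA scaler_nat mulr2n opprD.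
  by rewrite [x + (- x - x)]addrA subrr sub0r enormB.
by rewrite E S mulNr mulrN.
Qed.

(** On the annulus the integrand is [nearker], so the bound does not depend on the inner radius e
    and survives e -> 0. *)
Lemma shell_quadratic :
  weight (fun z => enorm (x - z) ^+ 2 * shell z) /\
  wint (fun=> 1) (fun z => enorm (x - z) ^+ 2 * shell z) <=
    cnear * rho ^+ 2 / rho `^ alpha.
Proof.
have rho0 : 0 < rho by exact: lt_le_trans erho.
have me : measurable_fun [set: 'rV[R]_n] (fun z => enorm (x - z) ^+ 2).
  by apply: measurable_funX; exact: measurable_enormB.
have q0 z : 0 <= enorm (x - z) ^+ 2 * shell z by rewrite mulr_ge0// sqr_ge0.
split.
  apply: (@shell_scaled _ (rho ^+ 2)) => //; first exact: sqr_ge0.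
  move=> z xz; rewrite ger0_norm ?sqr_ge0//.
  by rewrite ler_pXn2r ?nnegrE ?enorm_ge0 ?(ltW rho0).
rewrite /wint; under eq_Rintegral do rewrite mul1r.
have le1 : (\int[mu]_z (enorm (x - z) ^+ 2 * shell z)%:E <=
    (cnear * rho ^+ 2 / rho `^ alpha)%:E)%E.
  apply: le_trans (integral_nearker_le alpha0 alpha2 x rho0).
  apply: ge0_le_integral; first exact: measurableT.
  - by move=> z _; rewrite lee_fin.
  - apply/measurable_EFinP; apply: measurable_fun_Rn; exact: measurable_funM.
  - apply/measurable_EFinP; apply: measurable_fun_Rn; exact: measurable_nearker.
  move=> z _; rewrite lee_fin shellE /nearker.
  case: ifPn => [/andP[_ ->]//|_]; rewrite mulr0.
  by case: ifP => // _; rewrite divr_ge0 ?sqr_ge0 ?powR_ge0.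
rewrite -lee_fin /Rintegral fineK// ge0_fin_numE.
  by rewrite (le_lt_trans le1)// ltry.
by apply: integral_ge0 => z _; rewrite lee_fin.
Qed.

(** I(x, rho) - I(x, e) is the integral of v z - v x against the kernel on the annulus. There v z -
    v x is below the paraboloid, whose linear part integrates to 0. *)
Lemma resid_shell v b K : L_alpha v -> 0 <= K ->
  (forall z, enorm (x - z) <= rho ->
    v z - v x <= dotv b (z - x) + K * enorm (x - z) ^+ 2) ->
  resid v rho x - K * (cnear * rho ^+ 2 / rho `^ alpha) <= resid v e x.
Proof.
move=> Lv K0 touch; have rho0 : 0 < rho by exact: lt_le_trans erho.
have [W1 I1] := shell_linear b; have [W2 I2] := shell_quadratic.
have We := weight_tailker alpha0 x e0; have Wr := weight_tailker alpha0 x rho0.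
have L1 := L_alpha_cst alpha0 (1 : R) : L_alpha (fun _ : 'rV[R]_n => 1).
have Lvx : L_alpha (fun z => v x - v z).
  have := L_alphaD (L_alpha_cst alpha0 (v x)) (L_alphaZ (-1) Lv).
  by under [X in L_alpha X -> _]eq_fun do rewrite mulN1r.
rewrite !residE//.
have -> : wint (fun z => v x - v z) (tailker rho x) =
  wint (fun z => v x - v z) (tailker e x) +
  wint (fun z => - 1 * (v x - v z)) shell.
  rewrite (wintZl (-1) Lvx weight_shell).
  have -> : shell = (fun z => tailker e x z + (-1) * tailker rho x z).
    by apply/funext => z; rewrite /shell mulN1r.
  rewrite (wintDr Lvx We (weight_scale (-1) Wr)) (wintZr (-1) Lvx Wr).
  ring.
have : wint (fun z => - 1 * (v x - v z)) shell <=
    wint (fun=> 1) (fun z => dotv b (z - x) * shell z +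
                      K * (enorm (x - z) ^+ 2 * shell z)).
  apply: wint_le (L_alphaZ (-1) Lvx) L1 weight_shell _ _.
    by apply: weight_add => //; exact: weight_scale.
  move=> z; rewrite mul1r mulN1r opprB mulrA -mulrDl shellE.
  case: ifPn => [/andP[_ h]|_]; last by rewrite !mulr0.
  by rewrite ler_wpM2r ?touch// invr_ge0 powR_ge0.
rewrite (wintDr L1 W1 (weight_scale K W2)) I1 add0r (wintZr K L1 W2).
move=> h; have := ler_wpM2l K0 I2; lra.
Qed.

End shell.

(* The gradient term b . (z - x) does not contribute, being odd about x. *)
Lemma resid_touch v x b K rho : fharmonic v -> 0 < rho -> 0 <= K ->
  (forall z, enorm (x - z) <= rho ->
    v z - v x <= dotv b (z - x) + K * enorm (x - z) ^+ 2) ->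
  resid v rho x <= K * (cnear * rho ^+ 2 / rho `^ alpha).
Proof.
move=> [Lv hv] rho0 K0 touch; rewrite -subr_le0.
apply: (cvgr_to_ge (hv x)).
near=> e; apply: (resid_shell _ _ Lv K0 touch).
  by near: e; exact: nbhs_right_gt.
by near: e; apply: nbhs_right_le.
Unshelve. all: by end_near. Qed.

Lemma touch_max v x r a : fharmonic v -> 0 < r -> 0 <= a ->
  (forall z, enorm (x - z) <= r -> {for z, continuous v}) ->
  (forall z, enorm (x - z) <= r -> v z <= v x + a) ->
  exists x1, [/\ enorm (x - x1) <= r / 2, v x <= v x1 &
    forall rho, 0 < rho -> rho <= r / 2 ->
      resid v rho x1 <= 4 * a / r ^+ 2 * (cnear * rho ^+ 2 / rho `^ alpha)].
Proof.
move=> hv r0 a0 cv va.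
have r20 : 0 < r ^+ 2 by rewrite exprn_gt0.
(* For a = 0 the coefficient K vanishes and no longer localises the maximiser; x itself is then a
   maximum of v. *)
have [a00|aN0] := eqVneq a 0.
  exists x; split=> // [|rho rho0 rhor]; first by rewrite subrr enorm0; lra.
  apply: (@resid_touch _ _ 0) => // [|z xz].
    by rewrite divr_ge0 ?(ltW r20)// mulr_ge0.
  rewrite -(scale0r (0 : 'rV[R]_n)) dotvZl a00 mulr0 !mul0r addr0 subr_le0.
  by have := va z; rewrite a00 addr0; apply; lra.
have {aN0} a_gt0 : 0 < a by rewrite lt_neqAle eq_sym aN0.
set K := 4 * a / r ^+ 2.
have K0 : 0 < K by rewrite divr_gt0// mulr_gt0.
have Kr : K * r ^+ 2 = 4 * a by rewrite /K divfK// gt_eqF.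
have cq z : enorm (x - z) <= r ->
    {for z, continuous (fun z => v z - K * enorm (x - z) ^+ 2)}.
  by move=> /cv; exact: continuous_sub_sqr.
have [x1 x1r x1max] := eball_max (ltW r0) cq.
have := x1max x; rewrite subrr enorm0 expr0n/= mulr0 subr0 => /(_ (ltW r0)) vx.
have := va _ x1r => vx1.
have x1r2 : enorm (x - x1) <= r / 2.
  have h : K * enorm (x - x1) ^+ 2 <= a by lra.
  rewrite -(@ler_pXn2r _ 2)// ?nnegrE ?enorm_ge0 ?divr_ge0 ?(ltW r0)//.
  rewrite -(ler_pM2l K0); have -> : K * (r / 2) ^+ 2 = K * r ^+ 2 / 4 by field.
  by rewrite Kr; lra.
have e20 := sqr_ge0 (enorm (x - x1)).
exists x1; split=> // [|rho rho0 rhor]; first by nra.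
(* 2 K (x1 - x) is the gradient of K |x - z|^2 at z = x1. *)
apply: (@resid_touch _ _ ((2 * K) *: (x1 - x))) => //; first exact: ltW.
move=> z zx1.
have xz : enorm (x - z) <= r by have := ler_enorm_tri x1 x z; lra.
have := x1max _ xz.
rewrite dotvZl !sqr_enorm !dotvE (dotvC z x) (dotvC x1 x) (dotvC z x1).
lra.
Qed.

End Touching.

(** * Harnack inequalities *)

Section Harnack.
Context {R : realType} {n : nat}.
Variable alpha : R.
Hypotheses (n0 : (0 < n)%N) (alpha0 : 0 < alpha) (alpha2 : alpha < 2).
Implicit Types (x y z : 'rV[R]_n) (r rho : R) (u v : 'rV[R]_n -> R).

Local Notation mu := (lebesgue_rV R n).
Local Notation p := (n%:R + alpha).
Local Notation tailker := (tailker alpha).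
Local Notation L_alpha := (L_alpha alpha).
Local Notation tail := (tail alpha).
Local Notation ktail := (ktail alpha).
Local Notation cnear := (cnear n alpha).
Local Notation cker_ub := (cker_ub n alpha).
Local Notation clow := (@clow R n alpha).
Local Notation resid := (resid alpha).
Local Notation fharmonic := (fharmonic alpha).

Lemma L_alphaN v : L_alpha v -> L_alpha (fun z => - v z).
Proof.
move=> /(L_alphaZ (-1)); rewrite (_ : (fun z => _) = (fun z => - v z))//.
by apply/funext => z; rewrite mulN1r.
Qed.

Lemma residN v rho x : 0 < rho -> L_alpha v ->
  resid (fun z => - v z) rho x = - resid v rho x.
Proof.
move=> rho0 Lv; have W := @weight_tailker R n alpha alpha0 rho x rho0.
have -> : (fun z => - v z) = (fun z => (-1) * v z).
  by apply/funext => z; rewrite mulN1r.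
by rewrite /resid /tail (wintZl (-1) Lv W) !mulN1r mulNr opprB opprK addrC.
Qed.

Lemma resid_addc v c rho x : 0 < rho -> L_alpha v ->
  resid (fun z => v z + c) rho x = resid v rho x.
Proof.
move=> rho0 Lv; have W := @weight_tailker R n alpha alpha0 rho x rho0.
have Lc := L_alpha_cst alpha0 c : L_alpha (fun _ : 'rV[R]_n => c).
have L1 := L_alpha_cst alpha0 (1 : R) : L_alpha (fun _ : 'rV[R]_n => 1).
rewrite /resid /ktail /tail (wintDl Lv Lc W).
have -> : wint (fun=> c) (tailker rho x) = c * wint (fun=> 1) (tailker rho x).
  rewrite -(wintZl c L1 W); congr wint.
  by apply/funext => z; rewrite mulr1.
ring.
Qed.

Lemma near0_eq_cvg (f g : R -> R) (l : R) : (forall e, 0 < e -> f e = g e) ->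
  f e @[e --> 0^'+] --> l -> g e @[e --> 0^'+] --> l.
Proof.
move=> fg; apply: cvg_trans; apply: near_eq_cvg; near=> e.
by rewrite fg//; near: e; exact: nbhs_right_gt.
Unshelve. all: by end_near. Qed.

Lemma fharmonicN v : fharmonic v -> fharmonic (fun z => - v z).
Proof.
move=> [Lv hv]; split=> [|x]; first exact: L_alphaN.
apply: (@near0_eq_cvg (fun e => - resid v e x)).
  by move=> e e0; rewrite residN.
by have := cvgN (hv x); rewrite oppr0; exact.
Qed.

Lemma fharmonic_addc v c : fharmonic v -> fharmonic (fun z => v z + c).
Proof.
move=> [Lv hv]; split=> [|x].
  exact: L_alphaD Lv (L_alpha_cst alpha0 c).
apply: (@near0_eq_cvg (fun e => resid v e x)); last exact: hv.
by move=> e e0; rewrite resid_addc.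
Qed.

Lemma strong_solution_fharmonic C u : 0 < C -> strong_solution C alpha u ->
  fharmonic u.
Proof.
move=> C0 [u0 Lu hu]; split=> // x; have [[_ cvu] fl] := hu x.
apply: (@near0_eq_cvg (truncated_integral alpha u x)).
  by move=> e e0; rewrite truncated_integralE.
have l0 : lim (truncated_integral alpha u x @ 0^'+) = 0.
  by move: fl => /eqP; rewrite /frac_laplacian mulf_eq0 (gt_eqF C0)/= => /eqP.
by rewrite -[X in _ --> X]l0; exact: cvu.
Qed.

Lemma tail_ge0 u rho x : (forall z, 0 <= u z) -> 0 <= tail u rho x.
Proof. by move=> u0; apply: wint_ge0 => // z; exact: tailker_ge0. Qed.

Lemma tail_le u c x x' rho rho' : L_alpha u -> (forall z, 0 <= u z) ->
  0 <= c -> 0 < rho -> 0 < rho' ->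
  (forall z, rho < enorm (x - z) ->
    rho' < enorm (x' - z) /\ enorm (x' - z) <= c * enorm (x - z)) ->
  tail u rho x <= c `^ p * tail u rho' x'.
Proof.
move=> Lu u0 c0 rho0 rho'0 H.
have W := weight_tailker alpha0 x rho0; have W' := weight_tailker alpha0 x' rho'0.
rewrite /tail -(wintZr (c `^ p) Lu W').
apply: (wint_le Lu Lu W (weight_scale _ W')) => z.
rewrite ler_wpM2l//; apply: tailker_le => //; [exact: ltW|exact: ltW|exact: H].
Qed.

Definition clower : R := 2 `^ p * 4 `^ alpha * (cnear / 4 + cker_ub).

Lemma clower_gt0 : 0 < clower.
Proof.
have h1 : 0 < cnear := cnear_gt0 alpha2.
have h2 : 0 < cker_ub := cker_ub_gt0 alpha0.
by rewrite /clower mulr_gt0 ?mulr_gt0 ?powR_gt0// addr_gt0// divr_gt0.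
Qed.

(** As - u <= 0 = - u x + u x, touching - u from above with a = u x gives a point x1 with u x1 <= u
    x and - I(x1, r / 4) at most a multiple of u x / r^alpha. So m(x1, r / 4) = u x1 k - I is
    bounded by u x, and moving the centre from x1 to x costs 2^p. *)
Lemma tail_le_clower u x r : fharmonic u -> (forall z, 0 <= u z) -> 0 < r ->
  (forall z, enorm (x - z) <= r -> {for z, continuous u}) ->
  tail u r x <= clower / r `^ alpha * u x.
Proof.
move=> hu u0 r0 cu; have [Lu _] := hu.
have [||x1 [x1r ux1 /(_ (r / 4))]] := @touch_max R n alpha alpha0 alpha2
    (fun z => - u z) x r (u x) (fharmonicN hu) r0 (u0 x).
- by move=> z zr; exact: (cvgN (cu _ zr)).
- by move=> z _; rewrite addNr oppr_le0.
have r40 : 0 < r / 4 by rewrite divr_gt0.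
have r4a : 0 < (r / 4) `^ alpha by rewrite powR_gt0.
have ra : 0 < r `^ alpha by rewrite powR_gt0.
rewrite residN// => /(_ r40) H.
have {}H : tail u (r / 4) x1 <=
    u x * ((cnear / 4 + cker_ub) / (r / 4) `^ alpha).
  have {}H : - resid u (r / 4) x1 <= u x * ((cnear / 4) / (r / 4) `^ alpha).
    have -> : u x * ((cnear / 4) / (r / 4) `^ alpha) =
        4 * u x / r ^+ 2 * (cnear * (r / 4) ^+ 2 / (r / 4) `^ alpha).
      by field; rewrite !gt_eqF.
    by apply: H; lra.
  have k1 := ktail_le alpha0 x1 r40.
  have k0 := ltW (ktail_gt0 n0 alpha0 x1 r40).
  have h2 : u x1 * ktail (r / 4) x1 <= u x * (cker_ub / (r / 4) `^ alpha).
    by apply: ler_pM => //; rewrite lerN2 in ux1.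
  by move: H; rewrite /resid opprB mulrDl mulrDr; lra.
have step : tail u r x <= 2 `^ p * tail u (r / 4) x1.
  apply: tail_le => // z zr.
  have h1 := ler_enorm_tri x x1 z; have h2 := ler_enorm_tri x1 x z.
  by rewrite (enormB x1 x) in h1; split; lra.
apply: (le_trans step); rewrite -ler_pdivlMl ?powR_gt0//.
apply: (le_trans H); rewrite /clower powR_div ?(ltW r0)//.
rewrite le_eqVlt; apply/orP; left; apply/eqP.
have h2 : 2 `^ p != 0 :> R by rewrite gt_eqF// powR_gt0.
have h4 : 4 `^ alpha != 0 :> R by rewrite gt_eqF// powR_gt0.
by field; rewrite h2 h4 gt_eqF.
Qed.

Lemma harnack_lower : exists2 C : R, 0 < C &
  forall u x r, fharmonic u -> (forall z, 0 <= u z) -> 0 < r ->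
  (forall z, enorm (x - z) <= r -> {for z, continuous u}) ->
  tail u r x <= C / r `^ alpha * u x.
Proof. by exists clower; [exact: clower_gt0|exact: tail_le_clower]. Qed.

(* x0 maximises [u z * (r - |x - z|) ^ n], so [u <= 2 ^ n * u x0] on the ball of
   radius [d / 2] around x0, [d] being the distance from x0 to the sphere; x1
   then comes from touching u by a paraboloid on that ball. *)
Lemma harnack_upper : exists eta C : R, [/\ 0 < eta, 0 < C &
  forall u x r, fharmonic u -> (forall z, 0 <= u z) -> 0 < r ->
  (forall z, enorm (x - z) <= r -> {for z, continuous u}) ->
  exists x1 d, [/\ 0 < d, d <= r, enorm (x - x1) <= r &
    u x * r ^+ n <= C * (d `^ p * tail u (eta * d) x1)]].
Proof.
have cl := clow_gt0 alpha n0 : 0 < clow.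
have cn : 0 < cnear := cnear_gt0 alpha2.
(* With eta <= t and eta <= 1/4 the paraboloid contributes at most half of the lower bound for
   [u x1 * ktail (eta * d) x1]; the other half is left for the tail. *)
pose t := clow / (2 * (16 * 2 ^+ n * cnear)).
have den0 : 0 < 16 * 2 ^+ n * cnear by apply: mulr_gt0 cn; apply: mulr_gt0; rewrite ?exprn_gt0.
have t0 : 0 < t by rewrite divr_gt0// mulr_gt0.
pose eta := Num.min (4^-1) t.
have eta0 : 0 < eta by rewrite lt_min invr_gt0 t0 andbT.
have eta4 : eta <= 4^-1 by rewrite ge_min lexx.
have etat : eta <= t by rewrite ge_min lexx orbT.
have eta2 : 16 * 2 ^+ n * cnear * eta ^+ 2 <= clow / 2.
  have -> : clow / 2 = 16 * 2 ^+ n * cnear * t.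
    have nz1 : 2 ^+ n != 0 :> R by rewrite expf_neq0.
    by rewrite /t; field; rewrite nz1 gt_eqF.
  by rewrite ler_pM2l//; nra.
have etaa : 0 < eta `^ alpha by rewrite powR_gt0.
have C0 : 0 < 2 / clow * eta `^ alpha by rewrite mulr_gt0// divr_gt0.
exists eta, (2 / clow * eta `^ alpha); split=> //.
move=> u x r hu u0 r0 cu.
have [ux0|uxN0] := eqVneq (u x) 0.
  exists x, r; split=> //; first by rewrite subrr enorm0 ltW.
  rewrite ux0 mul0r; apply: mulr_ge0; first exact: ltW.
  by apply: mulr_ge0; [exact: powR_ge0|exact: tail_ge0].
have ux_gt0 : 0 < u x by rewrite lt_neqAle eq_sym uxN0 u0.
have cf z : enorm (x - z) <= r ->
    {for z, continuous (fun z => u z * (r - enorm (x - z)) ^+ n)}.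
  by move=> /cu; exact: continuous_mul_exp.
have [x0 x0r x0max] := eball_max (ltW r0) cf.
have := x0max x; rewrite subrr enorm0 subr0 => /(_ (ltW r0)) hS.
set d := r - enorm (x - x0) in hS.
have d_ge0 : 0 <= d by rewrite subr_ge0.
have S0 : 0 < u x0 * d ^+ n by apply: lt_le_trans hS; rewrite mulr_gt0// exprn_gt0.
have d0 : 0 < d.
  rewrite lt_neqAle d_ge0 andbT; apply: contraTN S0 => /eqP <-.
  by rewrite expr0n (gtn_eqF n0) mulr0 ltxx.
have ux0 : 0 < u x0.
  by rewrite -(pmulr_lgt0 _ (exprn_gt0 n d0)).
have d20 : 0 < d / 2 by rewrite divr_gt0.
have a0 : 0 <= 2 ^+ n * u x0 by rewrite mulr_ge0 ?exprn_ge0.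
have near_x0 z : enorm (x0 - z) <= d / 2 -> enorm (x - z) <= r - d / 2.
  by have := ler_enorm_tri x0 x z; rewrite /d; lra.
have [||x1 [x1d ux1 /(_ (eta * d))]] := @touch_max R n alpha alpha0 alpha2
    u x0 (d / 2) (2 ^+ n * u x0) hu d20 a0.
- by move=> z /near_x0 h; apply: cu; lra.
- move=> z /near_x0 h.
  suff : u z <= 2 ^+ n * u x0 by have := u0 x0; lra.
  have h1 : u z * (d / 2) ^+ n <= u x0 * d ^+ n.
    apply: le_trans (x0max z _); last by lra.
    by rewrite ler_wpM2l// ler_pXn2r ?nnegrE//; lra.
  move: h1; rewrite expr_div_n mulrA ler_pdivrMr ?exprn_gt0//.
  by rewrite mulrAC ler_pM2r ?exprn_gt0// mulrC.
have ed0 : 0 < eta * d by rewrite mulr_gt0.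
have ed4 : eta * d <= d / 2 / 2 by nra.
move=> /(_ ed0 ed4) H.
exists x1, d; split=> //.
- by rewrite /d; have := enorm_ge0 (x - x0); lra.
- by have := ler_enorm_tri x0 x x1; rewrite /d in d0 x1d *; lra.
have eda : 0 < (eta * d) `^ alpha by rewrite powR_gt0.
have k := ktail_ge n0 alpha0 x1 ed0.
have E : 4 * (2 ^+ n * u x0) / (d / 2) ^+ 2 *
    (cnear * (eta * d) ^+ 2 / (eta * d) `^ alpha) =
    16 * 2 ^+ n * cnear * eta ^+ 2 * (u x0 / (eta * d) `^ alpha).
  by field; rewrite !gt_eqF.
have h1 : u x0 * (clow / (eta * d) `^ alpha) <= u x1 * ktail (eta * d) x1.
  by apply: ler_pM => //; rewrite ?divr_ge0 ?(ltW cl) ?(ltW eda) ?(ltW ux0).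
have h2 : 16 * 2 ^+ n * cnear * eta ^+ 2 * (u x0 / (eta * d) `^ alpha) <=
    clow / 2 * (u x0 / (eta * d) `^ alpha).
  by rewrite ler_wpM2r// divr_ge0 ?(ltW eda) ?(ltW ux0).
have h3 : clow / 2 * (u x0 / (eta * d) `^ alpha) <= tail u (eta * d) x1.
  move: H; rewrite E /resid => H.
  have e1 : u x0 * (clow / (eta * d) `^ alpha) = clow * (u x0 / (eta * d) `^ alpha) by ring.
  by rewrite e1 in h1; lra.
apply: (le_trans hS).
have da : 0 < d `^ alpha by rewrite powR_gt0.
have -> : u x0 * d ^+ n = 2 / clow * eta `^ alpha *
    (d `^ p * (clow / 2 * (u x0 / (eta * d) `^ alpha))).
  rewrite powRDn// powRM ?(ltW eta0) ?(ltW d0)//.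
  by field; rewrite !gt_eqF// exprn_gt0.
rewrite ler_wpM2l//; first by rewrite mulr_ge0 ?divr_ge0 ?(ltW cl) ?powR_ge0.
by rewrite ler_wpM2l// powR_ge0.
Qed.

End Harnack.

(** * Harnack bounds between different points, and the Liouville theorem for continuous solutions *)

Section HarnackShift.
Context {R : realType} {n : nat}.
Variable alpha : R.
Hypotheses (n0 : (0 < n)%N) (alpha0 : 0 < alpha) (alpha2 : alpha < 2).
Implicit Types (x y z : 'rV[R]_n) (r rho : R) (u v : 'rV[R]_n -> R).

Local Notation mu := (lebesgue_rV R n).
Local Notation p := (n%:R + alpha).
Local Notation tailker := (tailker alpha).
Local Notation L_alpha := (L_alpha alpha).
Local Notation tail := (tail alpha).
Local Notation fharmonic := (fharmonic alpha).

(** q minimises u on the ball of radius r / 4 about x. That ball lies between distances r / 2 and 3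
    r from y, so the tail about y dominates the integral of u over it up to the factor (3 r)^p. *)
Lemma min_eball_le_tail u x y r : L_alpha u -> (forall z, 0 <= u z) -> 0 < r ->
  enorm (x - y) = 2 * r ->
  (forall z, enorm (x - z) <= r / 4 -> {for z, continuous u}) ->
  exists2 q, enorm (x - q) <= r / 4 &
    u q * (2 * (r / 4 / n%:R)) ^+ n <= (3 * r) `^ p * tail u (r / 2) y.
Proof.
move=> Lu u0 r0 xy cu; have r40 : 0 < r / 4 by rewrite divr_gt0.
have cNu z : enorm (x - z) <= r / 4 -> {for z, continuous (fun z => - u z)}.
  by move=> zr; exact: (cvgN (cu _ zr)).
have [q qr qmin] := eball_max (ltW r40) cNu; exists q => //.
have r20 : 0 < r / 2 by rewrite divr_gt0.
have W := weight_tailker alpha0 y r20.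
pose B := eball x (r / 4).
have mB : measurable (B : set (Rn R n)).
  by apply: measurable_Rn; exact: measurable_eball.
have B_tail z : \1_B z <= (3 * r) `^ p * tailker (r / 2) y z :> R.
  rewrite indicE; have [|_] := boolP (z \in B); last first.
    by rewrite mulr_ge0 ?powR_ge0 ?tailker_ge0.
  rewrite inE /B /eball/= => xz.
  have h1 := ler_enorm_tri z x y; have h2 := ler_enorm_tri x y z.
  rewrite (enormB z y) in h1; rewrite (enormB y x) in h2.
  have h3 : r / 2 < enorm (y - z) by lra.
  have yz : 0 < enorm (y - z) by lra.
  rewrite /tailker h3 ler_pdivlMr ?powR_gt0// mul1r.
  apply: ge0_ler_powR; first exact/ltW/p_gt0.
  - by rewrite nnegrE ltW.
  - by rewrite nnegrE mulr_ge0// ltW.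
  - lra.
have WB : weight alpha (\1_B : 'rV[R]_n -> R).
  apply: (weight_le _ (weight_scale ((3 * r) `^ p) W)).
    by apply: measurable_indic; exact: measurable_eball.
  move=> z; rewrite !ger0_norm// mulr_ge0 ?powR_ge0 ?tailker_ge0//.
have Lq := L_alpha_cst alpha0 (u q) : L_alpha (fun _ : 'rV[R]_n => u q).
have le1 : wint (fun=> u q) (\1_B : 'rV[R]_n -> R) <=
    wint u (fun z => (3 * r) `^ p * tailker (r / 2) y z).
  apply: (wint_le Lq Lu WB (weight_scale _ W)) => z.
  have [zB|zB] := boolP (z \in B).
    apply: ler_pM => //.
    by move: zB; rewrite inE => /qmin; rewrite lerN2.
  rewrite indicE (negbTE zB) mulr0 mulr_ge0// mulr_ge0 ?powR_ge0//.
  exact: tailker_ge0.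
rewrite (wintZr _ Lu W) in le1; apply: le_trans le1.
have L1 := L_alpha_cst alpha0 (1 : R) : L_alpha (fun _ : 'rV[R]_n => 1).
have -> : wint (fun=> u q) (\1_B : 'rV[R]_n -> R) = u q * fine (mu B).
  rewrite -[u q in LHS]mulr1 (wintZl (u q) L1 WB); congr (_ * _).
  rewrite /wint; under eq_Rintegral do rewrite mul1r.
  by rewrite /Rintegral integral_indic// setIT.
rewrite ler_wpM2l//.
have := lebesgue_eball_ge x n0 r40; have := lebesgue_eball_le x r40.
by rewrite -/B; case: (mu B) => [t| |].
Qed.

(** Continuity is assumed only near x, since y is later a point where u may be discontinuous; u is
    therefore controlled by its tail about y and not by u y. The upper bound leaves a tail about x1.
    Its part near y is moved to q, where the lower Harnack bound and [min_eball_le_tail] lead back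
    to the tail about y. *)
Lemma harnack_shift : exists2 C : R, 0 < C &
  forall u x y r, fharmonic u -> (forall z, 0 <= u z) -> 0 < r ->
  (forall z, enorm (x - z) <= r -> {for z, continuous u}) ->
  enorm (x - y) = 2 * r ->
  u x <= C * (r `^ alpha * tail u (r / 2) y).
Proof.
have [eta [C [eta0 C0 UB]]] := harnack_upper n0 alpha0 alpha2.
have [cl cl0 LB] := harnack_lower n0 alpha0 alpha2.
pose c := 3 / eta + 1.
have c0 : 0 < c by rewrite addr_gt0// divr_gt0.
pose b := (2 / 4 / n%:R) ^+ n : R.
have b0 : 0 < b by rewrite exprn_gt0// divr_gt0 ?divr_gt0// ltr0n.
exists (C * c `^ p * (1 + cl * 4 `^ alpha * 3 `^ p / b)).
  apply: mulr_gt0; first by rewrite mulr_gt0// powR_gt0.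
  apply: addr_gt0 => //; apply: divr_gt0 => //.
  by apply: mulr_gt0; [apply: mulr_gt0 => //|]; exact: powR_gt0.
move=> u x y r hu u0 r0 cu xy; have [Lu _] := hu.
have [x1 [d [d0 dr xx1 H]]] := UB u x r hu u0 r0 cu.
have cu4 z : enorm (x - z) <= r / 4 -> {for z, continuous u}.
  by move=> h; apply: cu; lra.
have [q qr Hq] := min_eball_le_tail Lu u0 r0 xy cu4.
have r40 : 0 < r / 4 by rewrite divr_gt0.
have r20 : 0 < r / 2 by rewrite divr_gt0.
have ed0 : 0 < eta * d by rewrite mulr_gt0.
have LBq : tail u (r / 4) q <= cl / (r / 4) `^ alpha * u q.
  apply: (LB _ _ _ hu u0 r40) => z zq; apply: cu.
  clear -qr zq r0; by have := ler_enorm_tri q x z; lra.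
set A := tail u (r / 2) y in Hq *.
set c' := c * r / d.
have c'0 : 0 <= c' by rewrite divr_ge0 ?mulr_ge0 ?(ltW c0) ?(ltW r0) ?(ltW d0).
have W1 := weight_tailker alpha0 x1 ed0; have Wy := weight_tailker alpha0 y r20.
have Wq := weight_tailker alpha0 q r40.
have tx1 : tail u (eta * d) x1 <= c' `^ p * (A + tail u (r / 4) q).
  rewrite /A /tail -(wintDr Lu Wy Wq) -(wintZr _ Lu (weight_add Wy Wq)).
  apply: (wint_le Lu Lu W1 (weight_scale _ (weight_add Wy Wq))) => z.
  rewrite ler_wpM2l//.
  have far_le (t : R) : eta * d < t -> t + 3 * r <= c' * t.
    move=> dt; have h : 3 * r <= 3 * r / (eta * d) * t.
      rewrite mulrAC ler_pdivlMr//; apply: ler_wpM2l; last exact: ltW.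
      by rewrite mulr_ge0// ltW.
    have h2 : t <= r / d * t.
      by rewrite ler_peMl ?ler_pdivlMr ?mul1r// ltW// (lt_trans ed0).
    have E : c' * t = 3 * r / (eta * d) * t + r / d * t.
      by rewrite /c' /c; field; rewrite !gt_eqF.
    by rewrite addrC E; exact: lerD.
  (* A point z within r / 2 of y has distance more than r / 4 from q, so one of the two kernels
     always dominates. *)
  have [hy|hy] := ltP (r / 2) (enorm (y - z)).
    apply: (@le_trans _ _ (c' `^ p * tailker (r / 2) y z)).
      apply: tailker_le => //; [exact: ltW|exact: ltW|move=> /far_le h; split=> //].
      apply: le_trans h; have h1 := ler_enorm_tri x y z.
      have h2 := ler_enorm_tri x1 x z; rewrite (enormB y x) in h1.
      clear -h1 h2 xy xx1; lra.
    by rewrite ler_wpM2l ?powR_ge0// lerDl tailker_ge0.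
  apply: (@le_trans _ _ (c' `^ p * tailker (r / 4) q z)).
    apply: tailker_le => //; [exact: ltW|exact: ltW|move=> /far_le h; split].
      have h1 := ler_enorm_tri z x y; have h2 := ler_enorm_tri q x z.
      by rewrite (enormB z y) in h1; clear -h1 h2 xy qr hy r0; lra.
    apply: le_trans h; have h1 := ler_enorm_tri x q z.
    have h2 := ler_enorm_tri x1 x z; rewrite (enormB q x) in h1.
    clear -h1 h2 xx1 qr r0; lra.
  by rewrite ler_wpM2l ?powR_ge0// lerDr tailker_ge0.
have A0 : 0 <= A by exact: tail_ge0.
set T := tail u (r / 4) q in LBq tx1; set X := tail u (eta * d) x1 in H tx1.
clear W1 Wy Wq; clearbody A T X.
have rp : 0 < r `^ alpha by rewrite powR_gt0.
have rn : 0 < r ^+ n by rewrite exprn_gt0.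
have uq : u q <= 3 `^ p / b * (r `^ alpha * A).
  have e1 : (2 * (r / 4 / n%:R)) ^+ n = r ^+ n * b.
    by rewrite /b -exprMn; congr (_ ^+ _); ring.
  move: Hq; rewrite e1 powRM ?(ltW r0)// [r `^ p]powRDn// => Hq.
  rewrite -(ler_pM2r (mulr_gt0 rn b0)); apply: (le_trans Hq).
  by rewrite le_eqVlt; apply/orP; left; apply/eqP; field; rewrite gt_eqF.
have tq : T <= cl * 4 `^ alpha * 3 `^ p / b * A.
  apply: (le_trans LBq).
  apply: (@le_trans _ _ (cl / (r / 4) `^ alpha * (3 `^ p / b * (r `^ alpha * A)))).
    by rewrite ler_wpM2l// divr_ge0 ?powR_ge0 ?(ltW cl0).
  rewrite powR_div ?(ltW r0)//.
  have h4 : 4 `^ alpha != 0 :> R by rewrite gt_eqF// powR_gt0.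
  by rewrite le_eqVlt; apply/orP; left; apply/eqP; field; rewrite h4 !gt_eqF.
rewrite -(ler_pM2r rn); apply: (le_trans H).
have -> : C * c `^ p * (1 + cl * 4 `^ alpha * 3 `^ p / b) * (r `^ alpha * A) * r ^+ n =
    C * (c `^ p * r `^ p * ((1 + cl * 4 `^ alpha * 3 `^ p / b) * A)).
  by rewrite [r `^ p]powRDn//; ring.
rewrite ler_pM2l//.
(* The uncontrolled distance d cancels, because c' d = c r. *)
have -> : c `^ p * r `^ p = d `^ p * c' `^ p.
  by rewrite -!powRM ?(ltW c0) ?(ltW r0) ?(ltW d0)//; congr (_ `^ _); rewrite /c'; field; rewrite gt_eqF.
rewrite -mulrA ler_wpM2l ?powR_ge0//; apply: (le_trans tx1).
by rewrite ler_wpM2l ?powR_ge0// mulrDl mul1r lerD2l.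
Qed.

Lemma harnack : exists2 C : R, 0 < C &
  forall u, fharmonic u -> (forall z, 0 <= u z) ->
  (forall z, {for z, continuous u}) -> forall x y, u x <= C * u y.
Proof.
have [C C0 HC] := harnack_shift.
have [cl cl0 LB] := harnack_lower n0 alpha0 alpha2.
(* The summand 1 covers x = y; otherwise [harnack_shift] at scale r = |x - y| / 2 is followed by the
   lower bound at y. *)
exists (1 + C * cl * 2 `^ alpha).
  by rewrite addr_gt0// !mulr_gt0 ?powR_gt0.
move=> u hu u0 cu x y.
have [->|xy] := eqVneq x y.
  by rewrite ler_peMl// lerDl !mulr_ge0 ?powR_ge0// ltW.
pose r := enorm (x - y) / 2.
have r0 : 0 < r.
  rewrite divr_gt0// lt_neqAle enorm_ge0 andbT eq_sym.
  by apply: contra xy => /eqP/enorm_eq0/eqP; rewrite subr_eq0.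
have r20 : 0 < r / 2 by rewrite divr_gt0.
have h1 : u x <= C * (r `^ alpha * tail u (r / 2) y).
  by apply: HC => //; rewrite /r; lra.
have h2 : tail u (r / 2) y <= cl / (r / 2) `^ alpha * u y.
  exact: (LB _ _ _ hu u0 r20).
have ra : 0 < r `^ alpha by rewrite powR_gt0.
have h3 : C * (r `^ alpha * tail u (r / 2) y) <=
    C * (r `^ alpha * (cl / (r / 2) `^ alpha * u y)).
  by rewrite ler_pM2l// ler_pM2l.
apply: (le_trans h1); apply: (le_trans h3).
rewrite powR_div ?(ltW r0)//.
have e2 : 2 `^ alpha != 0 :> R by rewrite gt_eqF// powR_gt0.
have -> : C * (r `^ alpha * (cl / (r `^ alpha / 2 `^ alpha) * u y)) =
    C * cl * 2 `^ alpha * u y by field; rewrite e2 gt_eqF.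
by rewrite mulrDl mul1r lerDr.
Qed.

Lemma liouville_continuous u : fharmonic u -> (forall z, 0 <= u z) ->
  (forall z, {for z, continuous u}) -> exists c, forall x, u x = c.
Proof.
move=> hu u0 cu; have [C C0 HC] := harnack.
have hinf : has_inf (range u).
  by split; [exists (u 0), 0|exists 0 => _ [z _ <-]].
pose c := inf (range u); exists c => x.
have uc z : c <= u z by apply: ge_inf; [case: hinf|exists z].
have hv := fharmonic_addc alpha0 (- c) hu.
apply/eqP; rewrite eq_le uc andbT; apply/ler_addgt0Pr => e e0.
have [_ [y _ <-] ye] : exists2 t, range u t & t < c + e / C.
  by apply: inf_adherent => //; rewrite divr_gt0.
have := HC _ hv _ _ x y; rewrite lerBlDr => h.
apply: (le_trans (h _ _)).
- by move=> z; rewrite subr_ge0.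
- by move=> z; exact: (cvgB (cu z) (cvg_cst c)).
rewrite addrC lerD2l -ler_pdivlMl// mulrC; lra.
Qed.

End HarnackShift.

(** * Continuity of the solutions *)

Section TailContinuity.
Context {R : realType} {n : nat}.
Variable alpha : R.
Hypotheses (n0 : (0 < n)%N) (alpha0 : 0 < alpha) (alpha2 : alpha < 2).
Implicit Types (x y z : 'rV[R]_n) (r rho e d : R) (u v : 'rV[R]_n -> R).

Local Notation mu := (lebesgue_rV R n).
Local Notation p := (n%:R + alpha).
Local Notation tailker := (tailker alpha).
Local Notation L_alpha := (L_alpha alpha).
Local Notation tail := (tail alpha).
Local Notation ktail := (ktail alpha).
Local Notation resid := (resid alpha).
Local Notation fharmonic := (fharmonic alpha).

Lemma continuous_powR (a t : R) : 0 < t -> {for t, continuous (fun s => s `^ a)}.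
Proof.
move=> t0; apply: differentiable_continuous; apply/derivable1_diffP.
by apply: (@derivable_powR _ _ a t); rewrite in_itv/= t0.
Qed.

Lemma tailker_cvg rho x (xk : nat -> 'rV[R]_n) z : 0 < rho ->
  enorm (xk k - z) @[k --> \oo] --> enorm (x - z) ->
  enorm (x - z) != rho ->
  tailker rho (xk k) z @[k --> \oo] --> tailker rho x z.
Proof.
move=> rho0 cD; rewrite neq_lt => /orP[h|h].
  have -> : tailker rho x z = 0 by rewrite /tailker ltNge (ltW h).
  have c0 : (fun _ : nat => 0 : R) @ \oo --> (0 : R) by exact: cvg_cst.
  apply: cvg_trans c0; apply: near_eq_cvg.
  near=> k; rewrite /tailker ltNge (_ : _ <= _)//.
  by apply/ltW; near: k; exact: cvgr_lt cD _ h.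
have D0 : 0 < enorm (x - z) by exact: lt_trans h.
have Dp : enorm (x - z) `^ p != 0 by rewrite gt_eqF// powR_gt0.
have -> : tailker rho x z = (enorm (x - z) `^ p)^-1 by rewrite /tailker h.
have c1 : (enorm (xk k - z) `^ p)^-1 @[k --> \oo] --> (enorm (x - z) `^ p)^-1.
  apply: cvgV => //.
  exact: (cvg_comp _ _ cD (continuous_powR (a := p) D0)).
apply: cvg_trans c1; apply: near_eq_cvg.
near=> k; rewrite /tailker (_ : rho < _)//.
by near: k; exact: cvgr_gt cD _ h.
Unshelve. all: by end_near. Qed.

(** v is merely measurable, so continuity comes from the kernel. Along x_k -> x the kernels converge
    off the sphere of radius rho about x, a null set, and for |x - x_k| <= rho / 2 they are at most
    2^p times [tailker (rho / 2) x]; dominated convergence applies. *)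
Lemma tail_continuous v rho x : 0 < rho -> L_alpha v ->
  {for x, continuous (tail v rho)}.
Proof.
move=> rho0 Lv; apply/continuous_enormP => e e0; apply: contrapT => H.
have r20 : 0 < rho / 2 by rewrite divr_gt0.
have /choice[xk xkP] : forall k : nat, exists t,
    enorm (x - t) <= rho / 2 / k.+1%:R /\ e < `|tail v rho x - tail v rho t|.
  move=> k; apply: contrapT => Hk; apply: H; exists (rho / 2 / k.+1%:R).
    by rewrite divr_gt0.
  by move=> t xt; rewrite leNgt; apply/negP => et; apply: Hk; exists t.
have xk2 k : enorm (x - xk k) <= rho / 2.
  by apply: (le_trans (xkP k).1); rewrite ler_pdivrMr// ler_peMr ?ler1n// ltW.
have cxk : enorm (x - xk k) @[k --> \oo] --> (0 : R).
  apply: (@squeeze_cvgr _ _ _ _ (fun=> 0) (fun k => rho / 2 / k.+1%:R)).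
  - by near=> k; rewrite enorm_ge0 (xkP k).1.
  - exact: cvg_cst.
  - rewrite -[X in _ --> X](mulr0 (rho / 2)); apply: cvgM; first exact: cvg_cst.
    exact: cvg_harmonic.
have cD z : enorm (xk k - z) @[k --> \oo] --> enorm (x - z).
  apply/cvgrPdist_le => d d0; near=> k.
  apply: (@le_trans _ _ (enorm (x - xk k))).
    have h1 := ler_enorm_tri (xk k) x z; have h2 := ler_enorm_tri x (xk k) z.
    by rewrite ler_norml; rewrite (enormB (xk k) x) in h2; lra.
  near: k; exact: cvgr_le cxk _ d0.
have W k := weight_tailker alpha0 (xk k) rho0.
have Wx := weight_tailker alpha0 x rho0.
have Wd := weight_scale (2 `^ p) (weight_tailker alpha0 x r20).
have mk k := measurable_int mu (weight_integrable Lv (W k)).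
have mx := measurable_int mu (weight_integrable Lv Wx).
have ig := weight_integrable (L_alpha_norm Lv) Wd.
have ae1 : {ae mu, forall z, setT z ->
    (v z * tailker rho (xk k) z)%:E @[k --> \oo] --> (v z * tailker rho x z)%:E}.
  exists [set z : Rn R n | enorm (x - z) = rho]; split.
  - apply: measurable_Rn.
    have -> : [set z | enorm (x - z) = rho] =
      setT `&` (fun z : 'rV[R]_n => enorm (x - z)) @^-1` [set rho] by rewrite setTI.
    exact: measurable_enormB.
  - exact: lebesgue_sphere0.
  move=> z /= hz; apply: contrapT => zr; apply: hz => _.
  apply: cvg_EFin; first by near=> k.
  apply: cvgM; first exact: cvg_cst.
  by apply: tailker_cvg => //; apply/eqP.
have ae2 : {ae mu, forall z k, setT z ->
    (`|(v z * tailker rho (xk k) z)%:E| <=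
     (`|v z| * (2 `^ p * tailker (rho / 2) x z))%:E)%E}.
  apply: aeW => z k _ /=; rewrite lee_fin normrM ler_wpM2l//.
  rewrite ger0_norm ?tailker_ge0//; apply: tailker_le => //; try exact: ltW.
  have h1 := ler_enorm_tri (xk k) x z; have h2 := ler_enorm_tri x (xk k) z.
  have h3 := xk2 k; rewrite (enormB (xk k) x) in h2.
  by move=> h; split; lra.
have [_ _ dom] := dominated_convergence measurableT mk mx ae1 ig ae2.
have {}dom : tail v rho (xk k) @[k --> \oo] --> tail v rho x.
  apply: fine_cvg; rewrite [X in _ --> X](_ : _ =
    (\int[mu]_z (v z * tailker rho x z)%:E)%E); first exact: dom.
  rewrite /tail /wint /Rintegral fineK//.
  exact: integrable_fin_num (weight_integrable Lv Wx).
move/cvgrPdist_le : dom => /(_ e e0) [N _ /(_ N (leqnn N))].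
by rewrite leNgt (xkP N).2.
Unshelve. all: by end_near. Qed.

End TailContinuity.

(** * Baire's theorem in a closed subset of R^n *)

Section Baire.
Context {R : realType} {n : nat}.
Implicit Types (x y z : 'rV[R]_n) (E : set 'rV[R]_n).

Lemma open_enormP E : (forall x, E x -> exists2 d : R, 0 < d &
    forall t, enorm (x - t) <= d -> E t) -> open E.
Proof. by move=> H; rewrite openE => x /H; rewrite /interior => /nbhs_enormP. Qed.

Lemma nearest_point E x : closed E -> E !=set0 -> ~ E x ->
  exists y, [/\ E y, 0 < enorm (x - y) &
    forall t, enorm (x - t) < enorm (x - y) -> ~ E t].
Proof.
move=> cE [y0 Ey0] Ex.
have cK : compact (eball x (enorm (x - y0)) `&` E).
  by apply: compact_closedI => //; exact: eball_compact.
have [||y yK ymin] := @EVT_min_rV R n (fun t => enorm (x - t)) _ _ cK.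
- by exists y0; split=> //; rewrite /eball/=.
- by apply: continuous_in_subspaceT => z _; exact: continuous_enormB.
move: yK; rewrite inE => -[y1 Ey]; exists y; split=> //.
  rewrite lt_neqAle enorm_ge0 andbT eq_sym; apply/eqP => /enorm_eq0/eqP.
  by rewrite subr_eq0 => /eqP xy; apply: Ex; rewrite xy.
move=> t xt Et; have := ymin t; rewrite inE leNgt xt /= => H.
suff : false by []; apply: H; split=> //; rewrite /eball/=.
exact: ltW (lt_le_trans xt y1).
Qed.

(** Otherwise every ball centred in E contains a smaller one, also centred in E, that misses a
    prescribed F k. A cluster point of the centres of the resulting nested balls lies in E but in no
    F k. *)
Lemma closed_baire E (F : nat -> set 'rV[R]_n) : closed E -> E !=set0 ->
  (forall k, closed (F k)) -> (forall x, E x -> exists k, F k x) ->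
  exists k y, E y /\ exists2 d : R, 0 < d &
    forall t, E t -> enorm (y - t) <= d -> F k t.
Proof.
move=> cE [y0 Ey0] cF EF; apply: contrapT => H.
(* The conditions on yd are premises under the existential, so that [choice] yields a total function
   that can be iterated. *)
have step k (yd : 'rV[R]_n * R) : exists yd' : 'rV[R]_n * R,
    E yd.1 -> 0 < yd.2 -> [/\ E yd'.1, 0 < yd'.2,
      eball yd'.1 yd'.2 `<=` eball yd.1 yd.2 &
      eball yd'.1 yd'.2 `&` F k = set0].
  case: yd => y d /=; have [[Ey d0]|h] := pselect (E y /\ 0 < d); last first.
    by exists (y, d) => Ey d0; exfalso; apply: h.
  have [t [Et yt Ft]] : exists t, [/\ E t, enorm (y - t) <= d / 2 & ~ F k t].
    apply: contrapT => h; apply: H; exists k, y; split=> //.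
    exists (d / 2) => [|t Et yt]; first by rewrite divr_gt0.
    by apply: contrapT => Ft; apply: h; exists t.
  have : nbhs t (~` F k) by apply: open_nbhs_nbhs; split=> //; exact: closed_openC.
  move=> /nbhs_enormP[e e0 eF]; exists (t, Num.min e (d / 2)) => _ _ /=.
  have d20 : 0 < d / 2 by rewrite divr_gt0.
  split=> //; first by rewrite lt_min e0.
    move=> z; rewrite /eball/= le_min => /andP[_ tz].
    by have := ler_enorm_tri t y z; lra.
  apply/seteqP; split=> // z [] /=; rewrite /eball/= le_min => /andP[tz _].
  exact: eF.
have /choice[S SP] := fun kyd : nat * ('rV[R]_n * R) => step kyd.1 kyd.2.
pose s := fix s k := if k is k'.+1 then S (k', s k') else (y0, 1).
have sE k : E (s k).1 /\ 0 < (s k).2.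
  by elim: k => [//|k [h1 h2]] /=; have [] := SP (k, s k) h1 h2.
have sP k : eball (s k.+1).1 (s k.+1).2 `<=` eball (s k).1 (s k).2 /\
    eball (s k.+1).1 (s k.+1).2 `&` F k = set0.
  by have [h1 h2] := sE k; have [] := SP (k, s k) h1 h2.
have nest k m : eball (s (m + k)%N).1 (s (m + k)%N).2 `<=` eball (s k).1 (s k).2.
  elim: m => [//|m IHm]; apply: subset_trans IHm; exact: (sP _).1.
have center k : eball (s k).1 (s k).2 (s k).1.
  by rewrite /eball/= subrr enorm0; exact/ltW/(sE k).2.
have [|c [_ cc]] := @eball_compact R n y0 1 ((fun k => (s k).1) @ \oo) _.
  by exists 0%N => // k _; have := nest 0%N k; rewrite addn0; apply.
have inball k : eball (s k).1 (s k).2 c.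
  have cB : closed (eball (s k).1 (s k).2).
    by apply: compact_closed; [exact: norm_hausdorff|exact: eball_compact].
  apply: cB => B nB; apply: cc nB; exists k => // m /= km.
  by have := nest k (m - k)%N; rewrite subnK//; apply.
have Ec : E c.
  by apply: cE => B nB; apply: cc nB; exists 0%N => // m _; exact: (sE m).1.
have [k Fk] := EF c Ec.
have : (eball (s k.+1).1 (s k.+1).2 `&` F k) c by split.
by rewrite (sP k).2.
Qed.

End Baire.

(** * Uniform bounds on the residuals over a countable closed cover *)

Section UniformResid.
Context {R : realType} {n : nat}.
Variable alpha : R.
Hypotheses (n0 : (0 < n)%N) (alpha0 : 0 < alpha) (alpha2 : alpha < 2).
Implicit Types (x y z : 'rV[R]_n) (r rho e d : R) (u v : 'rV[R]_n -> R).

Local Notation p := (n%:R + alpha).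
Local Notation L_alpha := (L_alpha alpha).
Local Notation tail := (tail alpha).
Local Notation ktail := (ktail alpha).
Local Notation resid := (resid alpha).
Local Notation fharmonic := (fharmonic alpha).

Lemma ktail_continuous rho x : 0 < rho -> {for x, continuous (ktail rho)}.
Proof.
by move=> rho0; apply: tail_continuous => //; exact: L_alpha_cst.
Qed.

Lemma ktail_noninc rho rho' x : 0 < rho -> rho <= rho' ->
  ktail rho' x <= ktail rho x.
Proof.
move=> rho0 rr'; have r'0 := lt_le_trans rho0 rr'.
have L1 := L_alpha_cst alpha0 (1 : R) : L_alpha (fun _ : 'rV[R]_n => 1).
apply: (wint_le L1 L1 (weight_tailker alpha0 x r'0) (weight_tailker alpha0 x rho0)).
move=> z; rewrite !mul1r /tailker; case: ifPn => [h|_].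
  by rewrite (le_lt_trans rr' h).
by case: ifP => // _; rewrite invr_ge0 powR_ge0.
Qed.

(* [resid v e x] need not be continuous in x since v is not; eliminating [v x]
   between two scales leaves a condition that is closed in x. *)
Definition unif_resid v k : set 'rV[R]_n := [set x | forall d e,
  0 < d -> d <= e -> e <= k.+1%:R^-1 ->
  `|tail v e x * ktail d x - tail v d x * ktail e x| <= k.+1%:R * ktail d x].

Lemma closed_unif_resid v k : L_alpha v -> closed (unif_resid v k).
Proof.
have aux (a b : R) : a - b <= a / 2 -> b <= 0 -> 0 < a / 2 -> False by lra.
move=> Lv; rewrite -[unif_resid v k]setCK; apply: open_closedC.
apply: open_enormP => x Hx.
have [d [e [d0 de ek lt]]] : exists d e : R, [/\ 0 < d, d <= e, e <= k.+1%:R^-1 &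
    k.+1%:R * ktail d x < `|tail v e x * ktail d x - tail v d x * ktail e x|].
  apply: contrapT => h; apply: Hx => d e d0 de ek; rewrite leNgt.
  by apply/negP => lt; apply: h; exists d, e.
have e0 := lt_le_trans d0 de.
pose G t := `|tail v e t * ktail d t - tail v d t * ktail e t| - k.+1%:R * ktail d t.
have cG : {for x, continuous G}.
  have c1 := @tail_continuous R n alpha n0 alpha0 v e x e0 Lv.
  have c2 := @tail_continuous R n alpha n0 alpha0 v d x d0 Lv.
  have c3 := @ktail_continuous e x e0; have c4 := @ktail_continuous d x d0.
  have c5 : {for x, continuous (fun t =>
      tail v e t * ktail d t - tail v d t * ktail e t)}.
    exact: (cvgB (cvgM c1 c4) (cvgM c2 c3)).
  have c6 : {for x, continuous (fun t =>
      `|tail v e t * ktail d t - tail v d t * ktail e t|)}.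
    exact: (cvg_norm c5).
  have c7 : {for x, continuous (fun t => k.+1%:R * ktail d t)}.
    exact: (cvgM (cvg_cst _) c4).
  exact: (cvgB c6 c7).
have G0 : 0 < G x by rewrite subr_gt0.
have G20 : 0 < G x / 2 by rewrite divr_gt0.
have [s s0 sP] := (continuous_enormP G x).1 cG _ G20.
exists s; first exact: s0.
move=> t xt Ht; have ht := sP t xt.
have Gt : G t <= 0 by rewrite subr_le0; exact: Ht.
have h := le_trans (ler_norm _) ht.
exact: aux h Gt G20.
Qed.

(** The quantity in [unif_resid] equals k(x, e) I(x, d) - k(x, d) I(x, e). Below some scale both
    residuals are at most 1/2, and k(x, e) <= k(x, d) for d <= e. *)
Lemma unif_resid_cover v x : fharmonic v -> exists k, unif_resid v k x.
Proof.
have aux (a b c f : R) : c <= 2^-1 -> f <= 2^-1 -> 0 <= b -> b <= a ->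
    b * c + a * f <= 1 * a by nra.
move=> [Lv hv]; have /cvgrPdist_le/(_ 2^-1) := hv x.
rewrite invr_gt0 ltr0n => /(_ isT)[r /= r0 rP].
have {}rP d : 0 < d -> d < r -> `|resid v d x| <= 2^-1.
  move=> d0 dr; have := rP d; rewrite /= !sub0r !normrN; apply=> //.
  by rewrite gtr0_norm.
have [k kr] : exists k : nat, k.+1%:R^-1 < r.
  exists (Num.trunc r^-1).+1; rewrite invf_plt ?posrE//.
  have /andP[_ h] := trunc_itv (ltW (etrans (invr_gt0 r) r0)).
  by apply: (lt_trans h); rewrite ltr_nat.
exists k => d e d0 de ek; have e0 := lt_le_trans d0 de.
have hd := rP d d0 (le_lt_trans de (le_lt_trans ek kr)).
have he := rP e e0 (le_lt_trans ek kr).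
have kde := ktail_noninc x d0 de.
have ke := ltW (ktail_gt0 n0 alpha0 x e0).
have -> : tail v e x * ktail d x - tail v d x * ktail e x =
    ktail e x * resid v d x - ktail d x * resid v e x by rewrite /resid; ring.
apply: (le_trans (ler_normB _ _)); rewrite !normrM.
rewrite (ger0_norm ke) (ger0_norm (le_trans ke kde)).
apply: (@le_trans _ _ (1 * ktail d x)); last first.
  by rewrite ler_wpM2r ?(le_trans ke)// ler1n.
exact: aux.
Qed.

(** In the same identity let d -> 0: I(x, d) vanishes and k(x, e) <= k(x, d), so division by k(x, d)
    leaves the bound on I(x, e). *)
Lemma unif_resid_bound v k x e : fharmonic v -> unif_resid v k x ->
  0 < e -> e <= k.+1%:R^-1 -> `|resid v e x| <= k.+1%:R.
Proof.
move=> [Lv hv] Hk e0 ek; apply/ler_addgt0Pr => c c0.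
have /cvgrPdist_le/(_ c c0)[r /= r0 rP] := hv x.
pose d := Num.min e (r / 2).
have d0 : 0 < d by rewrite lt_min e0 divr_gt0.
have de : d <= e by rewrite ge_min lexx.
have dr : d < r.
  by rewrite gt_min; apply/orP; right; rewrite ltr_pdivrMr// ltr_pMr// ltr1n.
have hd : `|resid v d x| <= c.
  by have := rP d; rewrite /= !sub0r !normrN; apply=> //; rewrite gtr0_norm.
have := Hk d e d0 de ek.
have kde := ktail_noninc x d0 de.
have ke := ltW (ktail_gt0 n0 alpha0 x e0).
have kd := ktail_gt0 n0 alpha0 x d0.
have -> : tail v e x * ktail d x - tail v d x * ktail e x =
    ktail e x * resid v d x - ktail d x * resid v e x by rewrite /resid; ring.
move=> h; rewrite -(ler_pM2l kd).
have -> : ktail d x * `|resid v e x| = `|ktail d x * resid v e x|.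
  by rewrite normrM (gtr0_norm kd).
have h2 : `|ktail e x * resid v d x| <= ktail d x * c.
  by rewrite normrM (ger0_norm ke); apply: ler_pM.
move: h h2; move: (ktail e x * _) (ktail d x * resid v e x) => a b h h2.
have -> : b = a - (a - b) by ring.
apply: (le_trans (ler_normB _ _)); rewrite mulrDr [_ * k.+1%:R]mulrC addrC.
exact: lerD.
Qed.

End UniformResid.

(** * Continuity along E and local boundedness near E *)

Section Regularity.
Context {R : realType} {n : nat}.
Variable alpha : R.
Hypotheses (n0 : (0 < n)%N) (alpha0 : 0 < alpha) (alpha2 : alpha < 2).
Implicit Types (x y z : 'rV[R]_n) (r rho e d : R) (u v : 'rV[R]_n -> R).
Implicit Types (E : set 'rV[R]_n).

Local Notation p := (n%:R + alpha).
Local Notation tailker := (tailker alpha).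
Local Notation L_alpha := (L_alpha alpha).
Local Notation tail := (tail alpha).
Local Notation ktail := (ktail alpha).
Local Notation resid := (resid alpha).
Local Notation fharmonic := (fharmonic alpha).
Local Notation clow := (@clow R n alpha).
Local Notation cnear := (cnear n alpha).
Local Notation cker_ub := (cker_ub n alpha).

Lemma small_powR (q K s : R) : 0 < q -> 0 <= K -> 0 < s ->
  exists2 t, 0 < t <= s & forall d, 0 < d -> d <= t -> d `^ alpha * K < q.
Proof.
move=> q0 K0 s0; have K1 : 0 < K + 1 by rewrite ltr_wpDl.
(* The denominator is K + 1 because K may be 0. *)
pose w := (q / (K + 1)) `^ alpha^-1.
have w0 : 0 < w by rewrite powR_gt0// divr_gt0.
exists (Num.min s w) => [|d d0]; first by rewrite lt_min s0 w0 ge_min lexx.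
rewrite le_min => /andP[_ dw].
have h : d `^ alpha <= q / (K + 1).
  have -> : q / (K + 1) = w `^ alpha.
    by rewrite /w -powRrM mulVf ?gt_eqF// powRr1// divr_ge0 ?ltW.
  by apply: ge0_ler_powR; rewrite ?nnegrE ?powR_ge0 ?(ltW alpha0) ?(ltW d0).
apply: le_lt_trans (_ : q / (K + 1) * K < q); first by rewrite ler_wpM2r.
by rewrite mulrAC ltr_pdivrMr// ltr_pM2l// ltrDl.
Qed.

Definition resid_bounded_near v E y (r0 M : R) := forall s e, E s ->
  enorm (y - s) <= r0 -> 0 < e -> e <= r0 -> `|resid v e s| <= M.

Lemma continuous_along v E y r0 M : L_alpha v -> 0 < r0 -> E y ->
  resid_bounded_near v E y r0 M ->
  forall c, 0 < c -> exists2 d, 0 < d &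
    forall s, E s -> enorm (y - s) <= d -> `|v s - v y| <= c.
Proof.
move=> Lv r00 Ey HM c c0.
have M0 : 0 <= M by apply: le_trans (HM y r0 Ey _ r00 (lexx _)); rewrite ?subrr ?enorm0 ?(ltW r00).
have cl : 0 < clow := clow_gt0 alpha n0.
have ccl : 0 < c * clow by rewrite mulr_gt0.
have [t /andP[t0 tr] /(_ t t0 (lexx t)) ht] :=
  small_powR ccl (mulr_ge0 (ler0n R 3) (addr_ge0 M0 ler01)) r00.
pose G s := tail v t s - v y * ktail t s.
have cG : {for y, continuous G}.
  have c1 := @tail_continuous R n alpha n0 alpha0 v t y t0 Lv.
  have c2 := @ktail_continuous R n alpha n0 alpha0 t y t0.
  exact: (cvgB c1 (cvgM (cvg_cst (v y)) c2)).
have [d d0 dP] := (continuous_enormP G y).1 cG 1 ltr01.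
exists (Num.min d r0) => [|s Es]; first by rewrite lt_min d0.
rewrite le_min => /andP[ysd ysr].
have h1 := HM s t Es ysr t0 tr.
have h2 : `|G y| <= M.
  have -> : G y = - resid v t y by rewrite /G /resid opprB.
  by rewrite normrN; apply: HM => //; rewrite subrr enorm0 ltW.
have h3 := dP s ysd.
have k0 := ktail_gt0 n0 alpha0 s t0.
have E1 : (v s - v y) * ktail t s = resid v t s + G y - (G y - G s).
  rewrite /resid /G.
  by move: (tail v t s) (tail v t y) (ktail t s) (ktail t y) => *; ring.
have h4 : `|v s - v y| * ktail t s <= 3 * (M + 1).
  rewrite -[X in _ * X](gtr0_norm k0) -normrM E1.
  apply: (le_trans (ler_normB _ _)).
  apply: (@le_trans _ _ (M + M + 1)).
    by apply: lerD => //; apply: (le_trans (ler_normD _ _)); exact: lerD.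
  by clear -M0 n0 alpha0 alpha2; lra.
have h5 := ktail_ge n0 alpha0 s t0.
have ta : 0 < t `^ alpha by rewrite powR_gt0.
have h6 : `|v s - v y| * (clow / t `^ alpha) <= 3 * (M + 1).
  by apply: le_trans h4; rewrite ler_wpM2l.
move: h6; rewrite mulrA ler_pdivrMr// mulrC => h6.
rewrite -(ler_pM2r cl) mulrC; apply: (le_trans h6); apply: ltW.
by rewrite mulrC.
Qed.

(** On E this is continuity along E. Off E, [harnack_shift] bounds u t by the tail about the nearest
    point y' of E, and that tail is u y' k(y', r / 2) - I(y', r / 2), where both u y' and the
    residual are controlled. *)
Lemma bounded_near u E y r0 M : fharmonic u -> (forall z, 0 <= u z) ->
  closed E -> (forall z, ~ E z -> {for z, continuous u}) ->
  0 < r0 -> E y -> resid_bounded_near u E y r0 M ->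
  exists A d, 0 < d /\ forall t, enorm (y - t) <= d -> u t <= A.
Proof.
move=> hu u0 cE cu r00 Ey HM; have [Lu _] := hu.
have M0 : 0 <= M by apply: le_trans (HM y r0 Ey _ r00 (lexx _)); rewrite ?subrr ?enorm0 ?(ltW r00).
have [C C0 HC] := harnack_shift n0 alpha0 alpha2.
have [d1 d10 d1P] := continuous_along Lu r00 Ey HM ltr01.
(* The nearest point y' is within 2 d of y, hence in the range of [d1P] and [HM]; d <= 1 gives
   r^alpha <= 1. *)
pose d := Num.min (d1 / 2) (Num.min (r0 / 2) 1).
have d0 : 0 < d.
  rewrite /d !lt_min; apply/and3P; split; last exact: ltr01.
    exact: divr_gt0.
  exact: divr_gt0.
have [dd1 dr0 dle1] : [/\ d <= d1 / 2, d <= r0 / 2 & d <= 1].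
  by split; rewrite /d !ge_min lexx ?orbT.
have ck := cker_ub_gt0 alpha0 : 0 < cker_ub.
clearbody d.
pose A := C * ((u y + 1) * cker_ub * 2 `^ alpha + M).
exists (u y + 1 + A), d; split=> // t yt.
have uy1 : 0 <= u y + 1 by rewrite addr_ge0.
have A0 : 0 <= A.
  apply: mulr_ge0; first exact: ltW.
  by apply: addr_ge0 => //; apply: mulr_ge0; [apply: mulr_ge0 => //; exact: ltW|exact: powR_ge0].
have [Et|Et] := pselect (E t).
  have yt1 : enorm (y - t) <= d1 by clear -yt dd1 d10 n0 alpha0 alpha2; lra.
  have h := le_trans (ler_norm _) (d1P t Et yt1).
  by clear -h A0 n0 alpha0 alpha2; lra.
have [y' [Ey' ty0 ty']] := nearest_point cE (ex_intro _ y Ey) Et.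
have tyd : enorm (t - y') <= d.
  apply: le_trans yt; rewrite (enormB y) leNgt; apply/negP => /ty'; exact.
(* The ball of radius r about t misses E, and y' is at distance exactly 2 r, as [harnack_shift]
   requires. *)
pose r := enorm (t - y') / 2.
have r_gt0 : 0 < r by rewrite divr_gt0.
have rE : enorm (t - y') = 2 * r by rewrite /r; field.
have r1 : r / 2 <= 1 by clear -tyd dle1 rE d0 n0 alpha0 alpha2; lra.
have rr0 : r / 2 <= r0 by clear -tyd dr0 rE r00 r_gt0 n0 alpha0 alpha2; lra.
have r20 : 0 < r / 2 by rewrite divr_gt0.
have yy' : enorm (y - y') <= 2 * d.
  by have := ler_enorm_tri t y y'; clear -tyd yt n0 alpha0 alpha2; lra.
have h1 : u t <= C * (r `^ alpha * tail u (r / 2) y').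
  apply: HC => // z tz; apply: cu => Ez; apply: (ty' z _ Ez).
  by rewrite rE; clear -tz r_gt0 n0 alpha0 alpha2; lra.
have yy1 : enorm (y - y') <= d1 by clear -yy' dd1 n0 alpha0 alpha2; lra.
have yyr : enorm (y - y') <= r0 by clear -yy' dr0 n0 alpha0 alpha2; lra.
have h2 : u y' <= u y + 1.
  have h := le_trans (ler_norm _) (d1P y' Ey' yy1).
  by clear -h n0 alpha0 alpha2; lra.
have h3 := HM y' (r / 2) Ey' yyr r20 rr0.
have h4 : tail u (r / 2) y' <= (u y + 1) * (cker_ub / (r / 2) `^ alpha) + M.
  have k1 := ktail_le alpha0 y' r20; have k0 := ltW (ktail_gt0 n0 alpha0 y' r20).
  have k2 : u y' * ktail (r / 2) y' <= (u y + 1) * (cker_ub / (r / 2) `^ alpha).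
    exact: ler_pM.
  have -> : tail u (r / 2) y' = u y' * ktail (r / 2) y' - resid u (r / 2) y'.
    by rewrite /resid opprB addrC subrK.
  by apply: lerD => //; rewrite lerNl; move: h3; rewrite ler_norml => /andP[].
have ra : 0 < r `^ alpha by rewrite powR_gt0.
have ra1 : r `^ alpha <= 1.
  rewrite -[leRHS]/((fun=> 1) alpha) -powR1.
  apply: ge0_ler_powR; rewrite ?nnegrE ?(ltW alpha0) ?(ltW r_gt0)//.
  by clear -tyd dle1 rE n0 alpha0 alpha2; lra.
apply: (le_trans h1); apply: (@le_trans _ _ A); last by rewrite lerDr.
rewrite /A ler_pM2l//.
apply: (@le_trans _ _ (r `^ alpha * ((u y + 1) * (cker_ub / (r / 2) `^ alpha) + M))).
  by rewrite ler_pM2l.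
rewrite mulrDr; apply: lerD.
  rewrite powR_div ?(ltW r_gt0)// le_eqVlt; apply/orP; left; apply/eqP.
  have e2 : 2 `^ alpha != 0 :> R by rewrite gt_eqF// powR_gt0.
  by field; rewrite e2 gt_eqF.
by rewrite ler_piMl.
Qed.

(** [om] is the limsup of v at y, with the value v y included: the infimum of the upper bounds of v
    on balls about y. *)
Lemma limsup_near v y A d : 0 < d -> (forall t, enorm (y - t) <= d -> v t <= A) ->
  exists om : R, (forall c, 0 < c -> exists2 s, 0 < s &
      forall t, enorm (y - t) <= s -> v t <= om + c) /\
    (forall c s, 0 < c -> 0 < s -> exists2 t, enorm (y - t) <= s & om - c < v t).
Proof.
move=> d0 vA.
pose W := [set w | exists2 s, 0 < s & forall t, enorm (y - t) <= s -> v t <= w].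
have hW : has_inf W.
  split; first by exists A, d.
  by exists (v y) => w [s s0]; apply; rewrite subrr enorm0 ltW.
exists (inf W); split=> [c c0|c s c0 s0].
  have [w [s s0 sw] wc] := inf_adherent c0 hW.
  by exists s => // t yt; apply: (le_trans (sw t yt)); exact: ltW.
apply: contrapT => h; have : inf W <= inf W - c.
  apply: ge_inf; first by case: hW.
  exists s => // t yt; rewrite leNgt; apply/negP => lt; apply: h.
  by exists t.
by rewrite lerBrDr gerDl leNgt c0.
Qed.

End Regularity.

(** * Upper semicontinuity at the points of E *)

Section Semicontinuity.
Context {R : realType} {n : nat}.
Variable alpha : R.
Hypotheses (n0 : (0 < n)%N) (alpha0 : 0 < alpha) (alpha2 : alpha < 2).
Implicit Types (x y z : 'rV[R]_n) (r rho e d : R) (u v : 'rV[R]_n -> R).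
Implicit Types (E : set 'rV[R]_n).

Local Notation p := (n%:R + alpha).
Local Notation tailker := (tailker alpha).
Local Notation L_alpha := (L_alpha alpha).
Local Notation tail := (tail alpha).
Local Notation ktail := (ktail alpha).
Local Notation resid := (resid alpha).
Local Notation fharmonic := (fharmonic alpha).
Local Notation clow := (@clow R n alpha).
Local Notation cnear := (cnear n alpha).
Local Notation cker_ub := (cker_ub n alpha).
Local Notation resid_bounded_near := (resid_bounded_near alpha).

Lemma wint_cstB_tail v b rho x : 0 < rho -> L_alpha v ->
  wint (fun z => b - v z) (tailker rho x) =
  (b - v x) * ktail rho x + resid v rho x.
Proof.
move=> rho0 Lv; have W := weight_tailker alpha0 x rho0.
have L1 := L_alpha_cst alpha0 (1 : R) : L_alpha (fun _ : 'rV[R]_n => 1).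
have -> : (fun z => b - v z) = (fun z => b * 1 + (-1) * v z).
  by apply/funext => z; rewrite mulr1 mulN1r.
rewrite (wintDl (L_alphaZ b L1) (L_alphaZ (-1) Lv) W).
rewrite (wintZl b L1 W) (wintZl (-1) Lv W) /resid /ktail /tail.
by move: (wint _ _) (wint _ _) => s t; ring.
Qed.

(* Away from y both kernels are dominated by the fixed kernel tailker s y. *)
Lemma shifted_tail_le v b y y' x1 s d : L_alpha v -> 0 < s -> 0 < d ->
  (forall t, enorm (y - t) <= s -> v t <= b) ->
  enorm (y - y') <= s / 2 -> enorm (y - x1) <= s / 2 ->
  enorm (x1 - y') <= 2 * d ->
  wint (fun z => b - v z) (tailker (4 * d) y') <=
  2 `^ p * wint (fun z => b - v z) (tailker (d / 4) x1) +
  (2 `^ p + 2 `^ p * 2 `^ p) * wint (fun z => `|b - v z|) (tailker s y).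
Proof.
move=> Lv s0 d0 vb yy' yx1 x1y'.
have d40 : 0 < 4 * d by rewrite mulr_gt0.
have d4 : 0 < d / 4 by rewrite divr_gt0.
have W1 := weight_tailker alpha0 y' d40; have W2 := weight_tailker alpha0 x1 d4.
have W3 := weight_tailker alpha0 y s0.
have Lh : L_alpha (fun z => b - v z).
  by apply: L_alphaD; [exact: L_alpha_cst|exact: L_alphaN].
have Lah := L_alpha_norm Lh.
set B := 2 `^ p + _.
have WB := weight_scale B W3; have WP := weight_scale (2 `^ p) W2.
rewrite -(wintZr _ Lh W2) -(wintZr _ Lah W3).
have L1 := L_alpha_cst alpha0 (1 : R) : L_alpha (fun _ : 'rV[R]_n => 1).
pose S z := (b - v z) * (2 `^ p * tailker (d / 4) x1 z) +
  `|b - v z| * (B * tailker s y z).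
have P0 : 0 <= 2 `^ p :> R by exact: powR_ge0.
have ineq z : (b - v z) * tailker (4 * d) y' z <= S z.
  have K1 := tailker_ge0 alpha (4 * d) y' z.
  have K2 := tailker_ge0 alpha (d / 4) x1 z.
  have K3 := tailker_ge0 alpha s y z.
  (* Near y the factor b - v z is nonnegative and the kernels compare directly. Far from y its sign
     is unknown, so both terms are bounded in absolute value; they account for the two summands of
     B. *)
  have [ys|ys] := leP (enorm (y - z)) s.
    have h0 : 0 <= b - v z by rewrite subr_ge0 vb.
    apply: (@le_trans _ _ ((b - v z) * (2 `^ p * tailker (d / 4) x1 z))).
      apply: (ler_wpM2l h0); apply: (tailker_le alpha0) => //; try exact: ltW.
      have h1 := ler_enorm_tri y' x1 z; have h2 := ler_enorm_tri x1 y' z.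
      rewrite (enormB y' x1) in h2.
      by clear -h1 h2 x1y' d0 n0 alpha0 alpha2 => h; split; lra.
    rewrite lerDl; apply: mulr_ge0; first exact: normr_ge0.
    by apply: mulr_ge0 K3; apply: addr_ge0 => //; exact: mulr_ge0.
  have f1 : tailker (4 * d) y' z <= 2 `^ p * tailker s y z.
    apply: (tailker_le alpha0) => //; try exact: ltW.
    have h1 := ler_enorm_tri y' y z.
    by clear -h1 yy' ys n0 alpha0 alpha2 => h; split; lra.
  have f2 : tailker (d / 4) x1 z <= 2 `^ p * tailker s y z.
    apply: (tailker_le alpha0) => //; try exact: ltW.
    have h1 := ler_enorm_tri x1 y z.
    by clear -h1 yx1 ys n0 alpha0 alpha2 => h; split; lra.
  have a0 := normr_ge0 (b - v z).
  have g1 : (b - v z) * tailker (4 * d) y' z <= `|b - v z| * (2 `^ p * tailker s y z).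
    apply: (@le_trans _ _ (`|b - v z| * tailker (4 * d) y' z)).
      exact: (ler_wpM2r K1 (ler_norm _)).
    exact: (ler_wpM2l a0 f1).
  have g2 : - ((b - v z) * (2 `^ p * tailker (d / 4) x1 z)) <=
      `|b - v z| * (2 `^ p * (2 `^ p * tailker s y z)).
    rewrite -mulNr; apply: (@le_trans _ _ (`|b - v z| * (2 `^ p * tailker (d / 4) x1 z))).
      apply: (ler_wpM2r (mulr_ge0 P0 K2)); rewrite -normrN; exact: ler_norm.
    exact: (ler_wpM2l a0 (ler_wpM2l P0 f2)).
  rewrite /S -lerBlDl; apply: (le_trans (lerD g1 g2)).
  by rewrite -mulrDr /B mulrDl mulrA.
have e1 : wint (fun z => b - v z) (fun z => 2 `^ p * tailker (d / 4) x1 z) +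
    wint (fun z => `|b - v z|) (fun z => B * tailker s y z) =
    \int[lebesgue_rV R n]_z S z.
  rewrite /wint -RintegralD//; [exact: weight_integrable Lh WP|exact: weight_integrable Lah WB].
rewrite e1; apply: le_Rintegral => //; first exact: weight_integrable Lh W1.
have := integrableD measurableT (weight_integrable Lh WP) (weight_integrable Lah WB).
by apply: eq_integrable => // z _.
Qed.

(** Suppose om > v y, and take x near y with v x close to om. Then x is off E, at distance d from
    its nearest point y'. Touching from above near x makes the integral of b - v about x1, with b =
    om + c, at most a small multiple of d^-alpha. About y', where v is close to v y, the same
    integral is at least a fixed multiple of d^-alpha minus M. For small d these contradict each
    other. *)
Lemma limsup_le v E y r0 M A d1 : fharmonic v -> closed E ->
  (forall z, ~ E z -> {for z, continuous v}) ->
  0 < r0 -> E y -> resid_bounded_near v E y r0 M ->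
  0 < d1 -> (forall t, enorm (y - t) <= d1 -> v t <= A) ->
  forall c, 0 < c -> exists2 d, 0 < d & forall t, enorm (y - t) <= d -> v t <= v y + c.
Proof.
move=> hv cE cv r00 Ey HM d10 vA; have [Lv _] := hv.
have M0 : 0 <= M by apply: le_trans (HM y r0 Ey _ r00 (lexx _)); rewrite ?subrr ?enorm0 ?(ltW r00).
have [om [om1 om2]] := limsup_near d10 vA.
suff omle : om <= v y.
  move=> c c0; have [s s0 sP] := om1 c c0; exists s => // t /sP h.
  by apply: (le_trans h); rewrite lerD2r.
rewrite leNgt; apply/negP => lt.
pose g := om - v y; have g0 : 0 < g by rewrite subr_gt0.
have cl : 0 < clow := clow_gt0 alpha n0.
have ck : 0 < cker_ub := cker_ub_gt0 alpha0.
have cn : 0 < cnear := cnear_gt0 alpha2.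
have p2 : 0 < 2 `^ p :> R by rewrite powR_gt0.
have a4 : 0 < 4 `^ alpha :> R by rewrite powR_gt0.
(* After multiplication by d^alpha the lower bound at y' is q up to bounded terms, the upper bound
   at x1 is c D, and the bounded terms become K d^alpha. So c is taken with c D <= q / 2, and then w
   with d^alpha K < q / 2 for d <= w. *)
pose q := g / 2 * clow / 4 `^ alpha.
have q0 : 0 < q by rewrite divr_gt0 ?mulr_gt0 ?divr_gt0.
pose D := 2 `^ p * (2 * ((cker_ub + cnear) * 4 `^ alpha)).
have D0 : 0 < D by rewrite mulr_gt0// mulr_gt0// mulr_gt0// addr_gt0.
pose c := Num.min (g / 2) (q / 2 / D).
have c0 : 0 < c.
  by rewrite /c lt_min; apply/andP; split; apply: divr_gt0 => //; exact: divr_gt0.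
have cg : c <= g / 2 by rewrite /c ge_min lexx.
have cD : c * D <= q / 2 by rewrite -ler_pdivlMr// /c ge_min lexx orbT.
clearbody c.
have [s s0 sP] := om1 c c0.
have g20 : 0 < g / 2 by rewrite divr_gt0.
have [e e0 eP] := continuous_along n0 alpha0 Lv r00 Ey HM g20.
pose b := om + c.
pose T := wint (fun z => `|b - v z|) (tailker s y).
have T0 : 0 <= T by apply: wint_ge0 => z; [exact: normr_ge0|exact: tailker_ge0].
pose K := M + (2 `^ p + 2 `^ p * 2 `^ p) * T.
have K0 : 0 <= K.
  have B0 : 0 <= 2 `^ p + 2 `^ p * 2 `^ p :> R.
    by rewrite addr_ge0 ?mulr_ge0 ?(ltW p2).
  exact: (addr_ge0 M0 (mulr_ge0 B0 T0)).
have q20 : 0 < q / 2 by rewrite divr_gt0.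
pose m := Num.min (s / 4) (Num.min (e / 2) (r0 / 4)).
have m0 : 0 < m.
  by rewrite /m !lt_min; apply/and3P; split; exact: divr_gt0.
have [ms me mr] : [/\ m <= s / 4, m <= e / 2 & m <= r0 / 4].
  by split; rewrite /m !ge_min lexx ?orbT.
clearbody m.
have [w /andP[w0 wm] wP] := small_powR alpha0 q20 K0 m0.
have [x yx omx] := om2 c w c0 w0.
(* Near y the values of v on E are at most v y + g / 2 = om - g / 2 <= om - c. *)
have Ex : ~ E x.
  move=> Ex; have yxe : enorm (y - x) <= e by clear -yx wm me e0 n0 alpha0 alpha2; lra.
  have h := le_trans (ler_norm _) (eP x Ex yxe).
  by rewrite /g in cg h; clear -h omx cg n0 alpha0 alpha2; lra.
have [y' [Ey' xy0 xy']] := nearest_point cE (ex_intro _ y Ey) Ex.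
set d := enorm (x - y') in xy0 xy'.
have dw : d <= w.
  apply: le_trans yx; rewrite (enormB y) leNgt; apply/negP => /xy'; exact.
have yy' : enorm (y - y') <= 2 * w.
  by have h := ler_enorm_tri x y y'; rewrite -/d in h; clear -h yx dw n0 alpha0 alpha2; lra.
have d20 : 0 < d / 2 by rewrite divr_gt0.
have c2 : 0 <= 2 * c by rewrite mulr_ge0// ltW.
(* This ball misses E, and on it v <= om + c < v x + 2 c, hence the choice a = 2 c. *)
have [||x1 [x1d vx1 /(_ (d / 4))]] := @touch_max R n alpha alpha0 alpha2
    v x (d / 2) (2 * c) hv d20 c2.
- move=> z xz; apply: cv; apply: xy'; clear -xz xy0 n0 alpha0 alpha2; lra.
- move=> z xz; have yz : enorm (y - z) <= s.
    have h := ler_enorm_tri x y z.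
    by clear -h xz yx dw wm ms w0 n0 alpha0 alpha2; lra.
  by have h := sP z yz; clear -h omx n0 alpha0 alpha2; lra.
have d40 : 0 < d / 4 by rewrite divr_gt0.
have d4 : 0 < 4 * d by rewrite mulr_gt0.
have da : 0 < d `^ alpha by rewrite powR_gt0.
move=> /(_ d40) H.
have {}H : resid v (d / 4) x1 <= 2 * c * (cnear * 4 `^ alpha) / d `^ alpha.
  have -> : 2 * c * (cnear * 4 `^ alpha) / d `^ alpha =
      4 * (2 * c) / (d / 2) ^+ 2 * (cnear * (d / 4) ^+ 2 / (d / 4) `^ alpha).
    by rewrite powR_div ?(ltW xy0)//; field; rewrite !gt_eqF.
  by apply: H; clear -xy0 n0 alpha0 alpha2; lra.
have yx1 : enorm (y - x1) <= s / 2.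
  have h := ler_enorm_tri x y x1.
  by clear -h x1d yx dw wm ms w0 n0 alpha0 alpha2; lra.
have up : wint (fun z => b - v z) (tailker (d / 4) x1) <=
    2 * c * ((cker_ub + cnear) * 4 `^ alpha) / d `^ alpha.
  rewrite wint_cstB_tail//.
  have k1 := ktail_le alpha0 x1 d40; have k0 := ltW (ktail_gt0 n0 alpha0 x1 d40).
  have h1 : (b - v x1) * ktail (d / 4) x1 <= 2 * c * (cker_ub / (d / 4) `^ alpha).
    apply: ler_pM => //.
      by rewrite subr_ge0; apply: sP; clear -yx1 s0 n0 alpha0 alpha2; lra.
    by rewrite /b; clear -vx1 omx n0 alpha0 alpha2; lra.
  have -> : 2 * c * ((cker_ub + cnear) * 4 `^ alpha) / d `^ alpha =
      2 * c * (cker_ub / (d / 4) `^ alpha) + 2 * c * (cnear * 4 `^ alpha) / d `^ alpha.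
    rewrite powR_div ?(ltW xy0)//.
    have e4 : 4 `^ alpha != 0 :> R by rewrite gt_eqF.
    by field; rewrite e4 gt_eqF.
  exact: lerD.
have lo : g / 2 * (clow / (4 * d) `^ alpha) - M <=
    wint (fun z => b - v z) (tailker (4 * d) y').
  rewrite wint_cstB_tail//.
  have k1 := ktail_ge n0 alpha0 y' d4.
  have yr : enorm (y - y') <= r0.
    by clear -yy' wm mr r00 n0 alpha0 alpha2; lra.
  have dr : 4 * d <= r0 by clear -dw wm mr r00 n0 alpha0 alpha2; lra.
  have := HM y' (4 * d) Ey' yr d4 dr; rewrite ler_norml => /andP[h _].
  have ye : enorm (y - y') <= e by clear -yy' wm me e0 n0 alpha0 alpha2; lra.
  have h2 := le_trans (ler_norm _) (eP y' Ey' ye).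
  apply: lerD => //; apply: ler_pM => //; first exact: ltW.
    by rewrite divr_ge0 ?(ltW cl) ?powR_ge0.
  by rewrite /g /b in h2 *; rewrite /g in cg; clear -h2 c0 n0 alpha0 alpha2; lra.
have yys : enorm (y - y') <= s / 2.
  by clear -yy' wm ms w0 n0 alpha0 alpha2; lra.
have x1y' : enorm (x1 - y') <= 2 * d.
  have h := ler_enorm_tri x x1 y'; rewrite -/d (enormB x1 x) in h.
  by clear -h x1d xy0 n0 alpha0 alpha2; lra.
have mid := shifted_tail_le Lv s0 xy0 sP yys yx1 x1y'.
rewrite -/b -/T in mid.
have {}mid : g / 2 * (clow / (4 * d) `^ alpha) - M <=
    2 `^ p * (2 * c * ((cker_ub + cnear) * 4 `^ alpha) / d `^ alpha) +
    (2 `^ p + 2 `^ p * 2 `^ p) * T.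
  apply: (le_trans lo); apply: (le_trans mid); rewrite lerD2r.
  by rewrite ler_wpM2l// ltW.
have {}mid : q / d `^ alpha <= c * D / d `^ alpha + K.
  have -> : q / d `^ alpha = g / 2 * (clow / (4 * d) `^ alpha).
    rewrite powRM ?(ltW xy0)// /q.
    have e4 : 4 `^ alpha != 0 :> R by rewrite gt_eqF.
    by field; rewrite e4 gt_eqF.
  have -> : c * D / d `^ alpha + K =
      2 `^ p * (2 * c * ((cker_ub + cnear) * 4 `^ alpha) / d `^ alpha) +
      (2 `^ p + 2 `^ p * 2 `^ p) * T + M.
    by rewrite /D /K; move: (T) => T'; field; rewrite gt_eqF.
  by rewrite -lerBlDr.
move: mid; rewrite -(ler_pM2r da) mulrDl !divfK ?gt_eqF// => mid.
have := wP d xy0 dw; rewrite mulrC => wd.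
have : q < q; last by rewrite ltxx.
apply: (le_lt_trans mid); apply: (lt_le_trans (ler_ltD cD wd)).
by rewrite -splitr.
Qed.

End Semicontinuity.

(** * Conclusion: solutions are continuous, hence constant *)

Section Continuity.
Context {R : realType} {n : nat}.
Variable alpha : R.
Hypotheses (n0 : (0 < n)%N) (alpha0 : 0 < alpha) (alpha2 : alpha < 2).
Implicit Types (x y z : 'rV[R]_n) (u : 'rV[R]_n -> R) (E : set 'rV[R]_n).

(** [limsup_le] is applied to u and to - u. The local upper bound it asks for comes from
    [bounded_near] for u, and is 0 for - u because u >= 0. *)
Lemma continuous_resid_bounded u E y r0 M : fharmonic alpha u ->
  (forall z, 0 <= u z) -> closed E ->
  (forall z, ~ E z -> {for z, continuous u}) ->
  0 < r0 -> E y -> resid_bounded_near alpha u E y r0 M ->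
  {for y, continuous u}.
Proof.
move=> hu u0 cE cu r00 Ey HM; have [Lu _] := hu.
have [A [d1 [d10 uA]]] := bounded_near n0 alpha0 alpha2 hu u0 cE cu r00 Ey HM.
have up := limsup_le n0 alpha0 alpha2 hu cE cu r00 Ey HM d10 uA.
have cNu z : ~ E z -> {for z, continuous (fun z => - u z)}.
  by move=> /cu cz; exact: (cvgN cz).
have HNM : resid_bounded_near alpha (fun z => - u z) E y r0 M.
  by move=> s e Es ys e0 er; rewrite residN// normrN; exact: HM.
have Nu0 t : enorm (y - t) <= 1 -> - u t <= 0 by rewrite oppr_le0.
have lo := limsup_le n0 alpha0 alpha2 (fharmonicN alpha0 hu) cE cNu r00 Ey HNM
  ltr01 Nu0.
apply/continuous_enormP => e e0.
have [a a0 aP] := up e e0; have [b b0 bP] := lo e e0.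
exists (Num.min a b) => [|t]; first by rewrite lt_min a0.
rewrite le_min => /andP[/aP h1 /bP h2].
by rewrite ler_norml; clear -h1 h2 n0 alpha0 alpha2; lra.
Qed.

Lemma fharmonic_continuous u : fharmonic alpha u -> (forall z, 0 <= u z) ->
  forall z, {for z, continuous u}.
Proof.
move=> hu u0 z0; apply: contrapT => ncz0; have [Lu _] := hu.
pose U := [set z | exists2 d, 0 < d &
  forall t, enorm (z - t) <= d -> {for t, continuous u}].
have Ucont z : U z -> {for z, continuous u}.
  by move=> [d d0]; apply; rewrite subrr enorm0 ltW.
pose E := ~` U.
have cE : closed E.
  apply: open_closedC; apply: open_enormP => x [d d0 dP].
  exists (d / 2) => [|t xt]; first by rewrite divr_gt0.
  exists (d / 2) => [|s ts]; first by rewrite divr_gt0.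
  by apply: dP; have := ler_enorm_tri t x s; lra.
have cu z : ~ E z -> {for z, continuous u} by move=> /contrapT /Ucont.
have [||k [y [Ey [d d0 dP]]]] := closed_baire cE _
    (fun k => @closed_unif_resid R n alpha n0 alpha0 u k Lu) _.
- by exists z0 => /Ucont.
- by move=> x _; exact: unif_resid_cover.
(* Continuity of u at every t within d / 2 of y puts y in U, against y in E. *)
apply: Ey; have d20 : 0 < d / 2 by rewrite divr_gt0.
exists (d / 2) => // t yt; have [Et|/cu//] := pselect (E t).
have k0 : 0 < k.+1%:R^-1 :> R by rewrite invr_gt0.
apply: (continuous_resid_bounded hu u0 cE cu
  (_ : 0 < Num.min (d / 2) k.+1%:R^-1) Et (M := k.+1%:R)).
  by rewrite lt_min d20.
move=> s e Es; rewrite !le_min => /andP[ts _] e0 /andP[_ ek].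
apply: unif_resid_bound => //; apply: dP => //.
by have h := ler_enorm_tri t y s; clear -h ts yt n0 alpha0 alpha2; lra.
Qed.

End Continuity.

Theorem theorem2 (R : realType) (n : nat) (hn : (2 <= n)%N)
  (alpha : R) (halpha0 : 0 < alpha) (halpha2 : alpha < 2)
  (C_n_alpha : R) (hC : normalization_constant n alpha C_n_alpha)
  (u : 'rV[R]_n -> R) (hu : strong_solution C_n_alpha alpha u) :
  exists C : R, forall x : 'rV[R]_n, u x = C.
Proof.
have n0 : (0 < n)%N by exact: leq_trans hn.
have hf := strong_solution_fharmonic halpha0 hC.1 hu.
have [u0 _ _] := hu.
apply: (liouville_continuous n0 halpha0 halpha2 hf u0).
exact: (fharmonic_continuous n0 halpha0 halpha2 hf u0).
Qed.
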